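(* Let $J=\{1,\dots,d\}$ with $d\in\mathbb{N}$, or $J=\mathbb{N}$. Let $\boldsymbol{\sigma}=(\sigma_j)_{j\in J}$ be a sequence of positive reals with $\sum_{j\in J}\sigma_j^2<\infty$, and let $\boldsymbol{\beta}=(\beta_j)_{j\in J}$ be given by $1-\beta_j=\frac{1}{1+2\sigma_j^2}$ for every $j\in J$. Then for every $n\in\mathbb{N}$ the minimal errors for integration satisfy $$\frac{e_n(L_{\boldsymbol{\sigma}})}{e_0(L_{\boldsymbol{\sigma}})}=\frac{e_n(K_{\boldsymbol{\beta}})}{e_0(K_{\boldsymbol{\beta}})}=e_n(K_{\boldsymbol{\beta}}).$$
   Context: $\mu_0$ is the standard normal distribution on $\mathbb{R}$, and $\mu=\bigotimes_{j\in J}\mu_0$ on $\mathbb{R}^J$. $h_\nu$ is the univariate Hermite polynomial of degree $\nu\in\mathbb{N}_0$, normalized in $L^2(\mu_0)$. For a nonnegative sequence $\boldsymbol{\omega}$, $\ell^2(\boldsymbol{\omega})=\{\boldsymbol{x}\in\mathbb{R}^J:\sum_{j\in J}\omega_jx_j^2<\infty\}$. Gaussian kernel: for $\sum_{j\in J}\sigma_j^2<\infty$, $L_{\boldsymbol{\sigma}}(\boldsymbol{x},\boldsymbol{y})=\prod_{j\in J}\exp(-\sigma_j^2(x_j-y_j)^2)$ on the domain $\ell^2(\boldsymbol{\sigma}^2)$, where $\boldsymbol{\sigma}^2=(\sigma_j^2)_{j\in J}$. Hermite kernel: for $0<\beta_j<1$ with $\sum_{j\in J}\beta_j<\infty$,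 $K_{\boldsymbol{\beta}}(\boldsymbol{x},\boldsymbol{y})=\prod_{j\in J}\bigl(\sum_{\nu=0}^\infty\beta_j^\nu h_\nu(x_j)h_\nu(y_j)\bigr)$ on the domain $\ell^2(\boldsymbol{\beta})$. Both domains equal $\mathbb{R}^d$ if $J=\{1,\dots,d\}$. $H(M)$ denotes the reproducing kernel Hilbert space of real-valued functions with kernel $M$ and domain $\mathfrak{X}$; in both cases $\mu(\mathfrak{X})=1$ and $H(M)\subseteq L^2(\mu)$. A quadrature formula is $A(f)=\sum_{i=1}^k f(\boldsymbol{x}_i)a_i$ with $k\in\mathbb{N}$, $\boldsymbol{x}_i\in\mathfrak{X}$, $a_i\in\mathbb{R}$; also the zero algorithm $A=0$ (cost $0$) is admitted. Its worst-case error is $e(A,M)=\sup_{\|f\|_{H(M)}\le1}\bigl|\int_{\mathfrak{X}}f\,d\mu-A(f)\bigr|$, and $\operatorname{cost}(A)=\sum_{i=1}^k\operatorname{cost}(\boldsymbol{x}_i)$. If $J=\{1,\dots,d\}$, then $\operatorname{cost}(\boldsymbol{x})=1$ for every $\boldsymbol{x}$. If $J=\mathbb{N}$, a non-decreasing function $\$:\mathbb{N}_0\to[1,\infty)$ is fixed, and $\operatorname{cost}(\boldsymbol{x})=\$(\#\{j:x_j\ne0\})$ if $\boldsymbol{x}$ has finitely many non-zero components and $\operatorname{cost}(\boldsymbol{x})=\infty$ otherwise. For $n\in\mathbb{N}$, $e_n(M)=\inf\{e(A,M):\operatorname{cost}(A)\le n\}$, and $e_0(M)=\sup_{\|f\|_{H(M)}\le1}\bigl|\int_{\mathfrak{X}}f\,d\mu\bigr|$.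 *)

(* Defs.v *)
From HB Require Import structures.
From mathcomp Require Import all_boot all_order all_algebra.
From mathcomp Require Import finmap.
From mathcomp Require Import all_classical all_reals all_analysis.

Set Implicit Arguments.
Unset Strict Implicit.
Unset Printing Implicit Defensive.

Import Order.TTheory GRing.Theory Num.Theory.
Import numFieldNormedType.Exports.

Local Open Scope classical_set_scope.
Local Open Scope ring_scope.

(* [FiniteIndices d] stands for J = {1, ..., d} (0-based here) and
   [CountableIndices] for J = N. *)
Variant index_kind := FiniteIndices of nat | CountableIndices.

Definition nonempty_indices (D : index_kind) : bool :=
  if D is FiniteIndices d then (0 < d)%N else true.

Definition indices (D : index_kind) : countType :=
  match D with FiniteIndices d => 'I_d | CountableIndices => nat end.

Definition prodJ (R : realType) (D : index_kind) : (indices D -> R) -> R :=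
  match D return (indices D -> R) -> R with
  | FiniteIndices d => fun a => \prod_(j < d) a j
  | CountableIndices => fun a => limn (fun n => \prod_(j < n) a j)
  end.

Definition sumJ_finite (R : realType) (D : index_kind)
    (a : indices D -> R) : Prop :=
  (\esum_(j in [set: indices D]) (a j)%:E < +oo)%E.

Definition coord_preimages (R : realType) (D : index_kind) :
    set (set (indices D -> R)) :=
  [set A | exists j : indices D, exists2 B : set R,
     measurable B & A = [set x | B (x j)]].

Definition RJ (R : realType) (D : index_kind) : measurableType _ :=
  g_sigma_algebraType (@coord_preimages R D).

Definition std_normal (R : realType) : probability (measurableTypeR R) R :=
  normal_prob (0 : R) 1.

(* By uniqueness of product measures, this determines mu. *)
Definition is_normal_product (R : realType) (D : index_kind)
    (mu : probability (RJ R D) R) : Prop :=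
  forall (s : seq (indices D)) (B : indices D -> set R),
    uniq s -> (forall j, measurable (B j)) ->
    mu [set x : RJ R D | forall j, j \in s -> B j (x j)] =
    (\prod_(j <- s) std_normal R (B j))%E.

Definition ell2 (R : realType) (D : index_kind) (w : indices D -> R) :
    set (RJ R D) :=
  [set x | sumJ_finite (fun j => w j * x j ^+ 2)].

(* He_n = (-1)^n exp(x^2/2) (d/dx)^n exp(-x^2/2), the monic orthogonal
   polynomials of the standard normal distribution. *)
Fixpoint hermite_monic (R : realType) (n : nat) : {poly R} :=
  if n is m.+1 then 'X * hermite_monic R m - (hermite_monic R m)^`() else 1.

Definition hermite (R : realType) (n : nat) (x : R) : R :=
  (hermite_monic R n).[x] /
  Num.sqrt (\int[std_normal R]_t ((hermite_monic R n).[t] ^+ 2))%R.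

Definition gauss_kernel (R : realType) (D : index_kind) (sigma : indices D -> R)
    (x y : RJ R D) : R :=
  prodJ (fun j => expR (- (sigma j ^+ 2 * (x j - y j) ^+ 2))).

Definition hermite_kernel (R : realType) (D : index_kind) (beta : indices D -> R)
    (x y : RJ R D) : R :=
  prodJ (fun j =>
    limn (series (fun nu => beta j ^+ nu * hermite nu (x j) * hermite nu (y j)))).

(* A Hilbert space of functions on X with reproducing kernel M: elements are
   identified with their evaluation functions, of which only the values on X
   are relevant. *)
Record RKHS (R : realType) (T : Type) (X : set T) (M : T -> T -> R) := {
  rkhs_space :> completeNormedModType R;
  rkhs_inner : rkhs_space -> rkhs_space -> R;
  rkhs_eval : rkhs_space -> T -> R;
  rkhs_inner_sym : forall f g, rkhs_inner f g = rkhs_inner g f;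
  rkhs_inner_linear : forall a f g h,
    rkhs_inner (a *: f + g) h = a * rkhs_inner f h + rkhs_inner g h;
  rkhs_inner_norm : forall f, rkhs_inner f f = `|f| ^+ 2;
  rkhs_eval_linear : forall a f g x, X x ->
    rkhs_eval (a *: f + g) x = a * rkhs_eval f x + rkhs_eval g x;
  rkhs_eval_inj : forall f g,
    (forall x, X x -> rkhs_eval f x = rkhs_eval g x) -> f = g;
  rkhs_reproducing : forall y, X y ->
    exists2 k, (forall x, X x -> rkhs_eval k x = M x y) &
               (forall f, rkhs_inner f k = rkhs_eval f y)
}.

(* A quadrature formula is given by its list of nodes and weights; the empty
   list is the zero algorithm. *)
Definition quadrature (R : realType) (D : index_kind) := seq (RJ R D * R).

Definition quad_apply (R : realType) (D : index_kind) (A : quadrature R D)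
    (f : RJ R D -> R) : R :=
  \sum_(p <- A) f p.1 * p.2.

Definition point_cost (R : realType) (price : nat -> R) (D : index_kind) :
    RJ R D -> \bar R :=
  match D return RJ R D -> \bar R with
  | FiniteIndices _ => fun=> 1%E
  | CountableIndices => fun x =>
      let S := [set j : nat | x j != 0] in
      if `[< finite_set S >] then (price #|` fset_set S|)%:E else +oo%E
  end.

Definition cost (R : realType) (price : nat -> R) (D : index_kind)
    (A : quadrature R D) : \bar R :=
  (\sum_(p <- A) point_cost price p.1)%E.

Definition nodes_in (R : realType) (D : index_kind) (X : set (RJ R D))
    (A : quadrature R D) : Prop :=
  forall p, p \in A -> X p.1.

Section Errors.
Context (R : realType) (D : index_kind) (mu : probability (RJ R D) R).
Context (X : set (RJ R D)) (M : RJ R D -> RJ R D -> R) (H : RKHS X M).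

Definition wc_error (A : quadrature R D) : \bar R :=
  ereal_sup [set `|\int[mu]_(x in X) (rkhs_eval f x)%:E
                   - (quad_apply A (rkhs_eval f))%:E|%E
            | f in [set f : H | `|f| <= 1]].

Definition initial_error : \bar R :=
  ereal_sup [set `|\int[mu]_(x in X) (rkhs_eval f x)%:E|%E
            | f in [set f : H | `|f| <= 1]].

Definition minimal_error (price : nat -> R) (n : nat) : \bar R :=
  if n is 0%N then initial_error else
  ereal_inf [set wc_error A | A in
    [set A | nodes_in X A /\ (cost price A <= n%:R%:E)%E]].

End Errors.

(* Main.v *)
(* Write s_j = sqrt (1 + beta_j), (S x)_j = s_j x_j and
   g x = exp (- (1/2) sum_j beta_j x_j ^ 2). By Mehler's formula,
   L (x, y) = c g(x) g(y) K (S x, S y) with c = prod_j sqrt (1 - beta_j ^ 2), so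
   F |-> sqrt c * g * (F o S) is an isometry of H(K) onto H(L). Since S maps
   the measure g mu to kappa mu, kappa = prod_j 1 / s_j, it multiplies integrals
   by r = sqrt c * kappa; as S preserves the number of non-zero coordinates,
   e_n(L) = r e_n(K) for all n, including n = 0. Functions in H(L) are bounded,
   so integration is represented in H(L) by some k; then
   k y = \int L (x, y) mu(dx) is a multiple of g, and |k| ^ 2 = \int k dmu = r
     ^ 2.
   Hence e_0(L) = r and e_0(K) = 1.
   Both sides of Mehler's formula solve the same first-order linear differential
   equation in t; for the series this is a recurrence of Hermite polynomials. *)
Require Import Defs.
From HB Require Import structures.
From mathcomp Require Import all_boot all_order all_algebra.
From mathcomp Require Import all_classical all_reals all_analysis.
From mathcomp Require Import measurable_realfun ring lra.

Import Order.TTheory GRing.Theory Num.Theory.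
Import numFieldNormedType.Exports.

Local Open Scope classical_set_scope.
Local Open Scope ring_scope.

(** * Change of variables *)

(** The kernel K is unbounded on the diagonal, so measurability and integrability of an element F of
    H(K) are not visible from its norm; both are read off from its partner in H(L), whose values are
    bounded by its norm because L (x, x) = 1. A partner always exists, since the set of F having one
    is a closed subspace containing the kernel sections. The scale s_j is dictated twice: exp (-
    beta_j u^2 / 2) times the standard normal density is a multiple of the density of N(0, 1 / (1 +
    beta_j)), and s_j^2 = 1 + beta_j also makes the exponents of Mehler's formula match in each
    coordinate. For infinitely many coordinates, all products but that of the Mehler kernels have
    factors in [0, 1]; their partial products decrease, hence converge, and summability keeps the
    relevant limits positive. The product of the Mehler kernels is a quotient of such products. The
    value of |k|^2 rests on sqrt (1 - beta_j^2) / sqrt (1 + beta_j) = sqrt (1 - beta_j): the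
    constant factor of k is thereby c kappa, and one more kappa comes from integrating g. *)

Section change_of_variables.
Context (R : realType) (d1 d2 : measure_display).
Context (T1 : measurableType d1) (T2 : measurableType d2).
Variables (mu1 : {measure set T1 -> \bar R}) (mu2 : {measure set T2 -> \bar R}).
Variables (w : T1 -> R) (phi : T1 -> T2) (c : R).
Hypotheses (w_ge0 : forall x, 0 <= w x) (mw : measurable_fun setT w).
Hypotheses (mphi : measurable_fun setT phi) (c_ge0 : 0 <= c).

Import HBNNSimple.

(** The hypothesis says that [phi] maps the measure with density [w] to [c] times [mu2], which is
    the case of indicators. Simple functions follow by linearity, and monotone convergence passes to
    their increasing limits. *)
Lemma ge0_integral_weighted_comp :
  (forall A, measurable A ->
    \int[mu1]_(x in phi @^-1` A) (w x)%:E = c%:E * mu2 A)%E ->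
  forall G : T2 -> \bar R, measurable_fun setT G -> (forall y, 0 <= G y)%E ->
  (\int[mu1]_x ((w x)%:E * G (phi x)) = c%:E * \int[mu2]_y G y)%E.
Proof.
move=> wc G mG G0.
pose g := nnsfun_approx measurableT mG.
have gG y : EFin (g n y) @[n --> \oo] --> G y by exact: cvg_nnsfun_approx.
have ndg y : nondecreasing_seq (fun n => g n y).
  by move=> m n mn; exact/lefP/nd_nnsfun_approx.
have step n : (\int[mu1]_x ((w x)%:E * (g n (phi x))%:E) =
               c%:E * \int[mu2]_y (g n y)%:E)%E.
  rewrite integralT_nnsfun sintegralE.
  rewrite ge0_mule_fsumr; last by move=> r; exact: nnsfun_mulemu_ge0.
  transitivity (\int[mu1]_x (\sum_(r \in range (g n))
      r%:E * ((w x)%:E * (\1_(g n @^-1` [set r]) (phi x))%:E)))%E.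
    apply: eq_integral => x _; rewrite [in LHS]fimfunE -fsumEFin//.
    rewrite ge0_mule_fsumr; last first.
      by move=> r; rewrite EFinM; exact: nnfun_muleindic_ge0.
    by apply: eq_fsbigr => r _; rewrite EFinM muleCA.
  have mpre r : measurable (g n @^-1` [set r]).
    by rewrite -(setTI (_ @^-1` _)); exact: (measurable_funPT (g n)).
  have mi r : measurable_fun setT
     (fun x => ((w x)%:E * (\1_(g n @^-1` [set r]) (phi x))%:E)%E).
    apply: emeasurable_funM; apply/measurable_EFinP => //.
    by apply: measurableT_comp => //; exact: measurable_indic.
  have i0 r x : (0 <= (w x)%:E * (\1_(g n @^-1` [set r]) (phi x))%:E)%E.
    by rewrite mule_ge0// lee_fin.
  rewrite ge0_integral_fsum//; last 2 first.
  - by move=> r; exact: emeasurable_funM.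
  - move=> r x _; have [r0|r0] := leP 0 r; first by rewrite mule_ge0.
    by rewrite preimage_nnfun0// indic0 mule0 mule0.
  apply: eq_fsbigr => r /set_mem [y _ gyr].
  have r0 : 0 <= r by rewrite -gyr.
  rewrite ge0_integralZl_EFin//.
  rewrite muleCA -wc//; congr (_ * _)%E.
  rewrite [RHS]integral_mkcond; apply: eq_integral => x _.
  rewrite patchE indicE.
  have -> : (x \in phi @^-1` (g n @^-1` [set r])) =
            (phi x \in g n @^-1` [set r]) by apply/idP/idP => /set_mem/mem_set.
  by case: ifPn => /= _; rewrite ?mule1 ?mule0.
have cvg1 : (\int[mu1]_x ((w x)%:E * (g n (phi x))%:E))%E @[n --> \oo] -->
            (\int[mu1]_x ((w x)%:E * G (phi x)))%E.
  have -> : (\int[mu1]_x ((w x)%:E * G (phi x)) =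
            \int[mu1]_x (limn (fun n => (w x)%:E * (g n (phi x))%:E)))%E.
    apply: eq_integral => x _; apply/esym/cvg_lim => //.
    by apply: cvgeZl => //; exact: gG.
  apply: cvg_monotone_convergence => //.
  - move=> n; apply: emeasurable_funM; apply/measurable_EFinP => //.
    exact: (measurableT_comp (measurable_funPT (g n)) mphi).
  - by move=> n x _; rewrite mule_ge0// lee_fin.
  - by move=> x _ m n mn; rewrite lee_wpmul2l ?lee_fin//; exact: ndg.
have cvg2 : (c%:E * \int[mu2]_y (g n y)%:E)%E @[n --> \oo] -->
            (c%:E * \int[mu2]_y G y)%E.
  apply: cvgeZl => //.
  have -> : (\int[mu2]_y G y = \int[mu2]_y (limn (fun n => (g n y)%:E)))%E.
    by apply: eq_integral => y _; apply/esym/cvg_lim => //; exact: gG.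
  apply: cvg_monotone_convergence => //.
  - by move=> n; exact/measurable_EFinP.
  - by move=> n y _; rewrite lee_fin.
  - by move=> y _ m n mn; rewrite lee_fin; exact: ndg.
rewrite (funext step) in cvg1; exact: (cvg_unique _ cvg1 cvg2).
Qed.

(** Since [w] is nonnegative, multiplying by it commutes with taking positive and negative parts, so
    the nonnegative case applies to each part. *)
Lemma integral_weighted_comp :
  (forall A, measurable A ->
    \int[mu1]_(x in phi @^-1` A) (w x)%:E = c%:E * mu2 A)%E ->
  forall G : T2 -> \bar R, mu2.-integrable setT G ->
  mu1.-integrable setT (fun x => (w x)%:E * G (phi x))%E /\
  (\int[mu1]_x ((w x)%:E * G (phi x)) = c%:E * \int[mu2]_y G y)%E.
Proof.
move=> wc G iG; have mG := measurable_int _ iG.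
have mwG : measurable_fun setT (fun x => (w x)%:E * G (phi x))%E.
  by apply: emeasurable_funM; [exact/measurable_EFinP|exact: measurableT_comp].
have wD x : (0 <= (w x)%:E)%E by rewrite lee_fin.
split.
  apply/integrableP; split=> //.
  under eq_integral do rewrite abseM (gee0_abs (wD _)).
  rewrite (ge0_integral_weighted_comp wc (fun y => `|G y|%E))//.
    by rewrite lte_mul_pinfty//; case/integrableP: iG.
  exact: measurableT_comp.
rewrite integralE.
have -> : funepos (fun x => (w x)%:E * G (phi x))%E =
          (fun x => (w x)%:E * funepos G (phi x))%E.
  by apply/funext => x; rewrite !funeposE maxe_pMr// mule0.
have -> : funeneg (fun x => (w x)%:E * G (phi x))%E =
          (fun x => (w x)%:E * funeneg G (phi x))%E.
  by apply/funext => x; rewrite !funenegE maxe_pMr// mule0 muleN.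
rewrite !(ge0_integral_weighted_comp wc)//; last 2 first.
- exact: measurable_funeneg.
- exact: measurable_funepos.
(* Distributivity over a difference in the extended reals needs a finite term: the integral of the
   negative part of the integrable [G]. *)
rewrite [in RHS]integralE [RHS]muleBr//; apply: fin_num_adde_defl;
  rewrite fin_numN.
by rewrite ge0_fin_numE ?integral_ge0// integral_funeneg_lt_pinfty.
Qed.

(** Pi-lambda argument: the sets satisfying the identity are stable under complements and countable
    disjoint unions, so a generating family closed under intersection suffices. *)
Lemma integral_weighted_preimage_dynkin (E : set (set T2)) :
  @measurable _ T2 = <<s E >> -> setI_closed E -> E setT ->
  (mu2 setT < +oo)%E ->
  (forall A, E A -> \int[mu1]_(x in phi @^-1` A) (w x)%:E = c%:E * mu2 A)%E ->
  forall A, measurable A ->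
    (\int[mu1]_(x in phi @^-1` A) (w x)%:E = c%:E * mu2 A)%E.
Proof.
move=> mE EI ET mu2fin Ew A mA.
have mpre B : measurable B -> measurable (phi @^-1` B).
  by move=> mB; rewrite -(setTI (_ @^-1` _)); exact: mphi.
have mwe B : measurable_fun B (fun x => (w x)%:E).
  by apply: measurable_funTS; exact/measurable_EFinP.
rewrite mE in mA; move: A mA; apply: (@dynkin_induction _ T2 E) => //.
- exact: Ew.
- move=> B mB wB.
  have split_w : (\int[mu1]_(x in phi @^-1` B) (w x)%:E +
                  \int[mu1]_(x in phi @^-1` (~` B)) (w x)%:E =
                  c%:E * mu2 B + c%:E * mu2 (~` B))%E.
    rewrite -ge0_integral_setU//; last 4 first.
    - exact: mpre.
    - by apply: mpre; exact: measurableC.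
    - by move=> x _; rewrite lee_fin.
    - by rewrite -preimage_setC; apply/disj_setPCl.
    rewrite -preimage_setU setUv Ew// -ge0_muleDr// -measureU//.
    + by rewrite setUv.
    + exact: measurableC.
    + by rewrite setICr.
  (* Finiteness allows the identity for [B] to be subtracted from the one for the whole space. *)
  have Bfin : (c%:E * mu2 B)%E \is a fin_num.
    rewrite fin_numM// ge0_fin_numE//.
    by apply: le_lt_trans mu2fin; apply: le_measure; rewrite ?inE.
  move: split_w; rewrite wB ![(c%:E * mu2 B + _)%E]addeC.
  by move=> /(congr1 (fun z => z - c%:E * mu2 B)%E); rewrite !addeK.
- move=> F mF tF wF.
  rewrite preimage_bigcup ge0_integral_bigcup//; last 3 first.
  - by move=> n; exact: mpre.
  - by move=> x _; rewrite lee_fin.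
  - by move=> i j _ _ [x [/= Fi Fj]]; apply: tF => //; exists (phi x).
  rewrite measure_bigcup//= -nneseriesZl//.
  rewrite (eq_eseriesr (fun n _ => wF n)).
  by apply: eq_eseriesl => n; rewrite in_setT.
Qed.

End change_of_variables.

(** * Gaussian integrals *)

Section standard_normal.
Context (R : realType).
Local Notation lambda := (@lebesgue_measure R).

(** [s] times the image of Lebesgue measure under multiplication by [s] gives half-open intervals
    their length, hence is Lebesgue measure by uniqueness. *)
Lemma lebesgue_measure_preimage_scale (s : R) (A : set (measurableTypeR R)) :
  0 < s -> measurable A ->
  (lambda ((fun x => s * x)%R @^-1` A) = s^-1%:E * lambda A)%E.
Proof.
move=> s0 mA.
have ms : measurable_fun setT
    ((fun x => s * x) : measurableTypeR R -> measurableTypeR R).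
  by apply: measurable_funM.
pose nu : {measure set (measurableTypeR R) -> \bar R} :=
  mscale (NngNum (ltW s0)) (pushforward lambda
    ((fun x => s * x) : measurableTypeR R -> measurableTypeR R)).
have nuE X : nu ms X = (s%:E * lambda ((fun x => s * x)%R @^-1` X))%E by [].
have -> : lambda A = nu ms A.
  apply: lebesgue_measure_unique => // X [[a b] /= ab <-].
  have pre : (fun x => s * x) @^-1` `]a, b] = `](a / s), (b / s)]%classic.
    apply/seteqP; split => x /=;
      by rewrite !in_itv/= ltr_pdivrMr// ler_pdivlMr// [x * s]mulrC.
  rewrite nuE pre !lebesgue_measure_itv/= !lte_fin ltr_pM2r ?invr_gt0//.
  case: ifPn => // _; last by rewrite mule0.
  by rewrite -!EFinB -EFinM mulrBr !mulrA ![s * _]mulrC !mulfK ?gt_eqF.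
by rewrite nuE muleA -EFinM mulVf ?gt_eqF// mul1e.
Qed.

Lemma ge0_integral_lebesgue_scale (s : R) (G : R -> \bar R) : 0 < s ->
  measurable_fun setT G -> (forall x, 0 <= G x)%E ->
  (\int[lambda]_x G (s * x)%R = s^-1%:E * \int[lambda]_x G x)%E.
Proof.
move=> s0 mG G0.
rewrite -(@ge0_integral_weighted_comp _ _ _ _ _ lambda lambda
  (cst 1) (fun x => s * x) s^-1)//.
- by apply: eq_integral => x _; rewrite mul1e.
- exact: measurable_funM.
- move=> A mA; rewrite -lebesgue_measure_preimage_scale// -[RHS]mul1e.
  apply: (@integral_cst _ _ _ lambda _ _ (1%:E)%E).
  have ms : measurable_fun setT (fun x : R => s * x) by exact: measurable_funM.
  by rewrite -(setTI (_ @^-1` _)); exact: ms.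
Qed.

(** [normal_prob] is by definition the integral of its density over a set, so this is the change of
    variables along the identity with constant 1. *)
Lemma ge0_integral_std_normal (G : R -> \bar R) :
  measurable_fun setT G -> (forall x, 0 <= G x)%E ->
  (\int[std_normal R]_x G x = \int[lambda]_x ((normal_pdf 0 1 x)%:E * G x))%E.
Proof.
move=> mG G0; rewrite -[LHS]mul1e.
rewrite -(@ge0_integral_weighted_comp _ _ _ _ _ lambda (std_normal R)
  (normal_pdf 0 1) id 1)//.
- by move=> x; exact: normal_pdf_ge0.
- exact: measurable_normal_pdf.
- by move=> A mA; rewrite mul1e.
Qed.

Lemma normal_pdf01E (x : R) : normal_pdf 0 1 x = normal_peak 1 * expR (- (x ^+
  2) / 2).
Proof. by rewrite normal_pdfE// /normal_fun subr0 expr1n. Qed.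

(** Completing the square: the integrand times the standard normal density is [q] times the density
    of N(m, 1 / (1 + 2a)), which integrates to 1. *)
Lemma integral_std_normal_gauss (a y : R) : 0 <= a ->
  (\int[std_normal R]_x (expR (- (a * (x - y) ^+ 2)))%:E =
   ((Num.sqrt (1 + 2 * a))^-1 * expR (- (a / (1 + 2 * a) * y ^+ 2)))%:E)%E.
Proof.
move=> a0.
have b0 : 0 < 1 + 2 * a by rewrite ltr_pwDl// mulr_ge0.
pose s := Num.sqrt (1 + 2 * a).
have s0 : 0 < s by rewrite sqrtr_gt0.
have s2 : s ^+ 2 = 1 + 2 * a by rewrite sqr_sqrtr// ltW.
pose m := 2 * a * y / (1 + 2 * a).
set q := _ * expR _.
have q0 : 0 <= q by rewrite mulr_ge0 ?expR_ge0// invr_ge0 sqrtr_ge0.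
have mexp : measurable_fun setT (fun x : R => expR (- (a * (x - y) ^+ 2))).
  apply: measurableT_comp => //; apply: measurableT_comp => //.
  apply: measurable_funM => //; apply: measurable_funX.
  exact: measurable_funB.
rewrite ge0_integral_std_normal//; last exact/measurable_EFinP.
transitivity (\int[lambda]_x (q%:E * (normal_pdf m s^-1 x)%:E))%E; last first.
  have int1 : (\int[lambda]_x (normal_pdf m s^-1 x)%:E = 1)%E.
    exact: integral_normal_pdf.
  rewrite ge0_integralZl_EFin// ?int1 ?mule1//.
  - by move=> x _; rewrite lee_fin normal_pdf_ge0.
  - by apply/measurable_EFinP; exact: measurable_normal_pdf.
apply: eq_integral => x _; rewrite -!EFinM; congr EFin.
rewrite normal_pdf01E normal_pdfE ?invr_eq0 ?gt_eqF// /normal_fun /normal_peak.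
rewrite exprVn s2.
rewrite (_ : (1 + 2 * a)^-1 * pi *+ 2 = (1 + 2 * a)^-1 * (pi *+ 2)); last first.
  by rewrite -mulrnAr.
rewrite expr1n mul1r sqrtrM ?invr_ge0 ?(ltW b0)// sqrtrV ?(ltW b0)// invfM
  invrK.
rewrite /q -/s mulrACA mulKf ?gt_eqF// -[LHS]mulrA -!expRD.
congr (_ * expR _); rewrite /m; field.
by rewrite gt_eqF.
Qed.

(** With s^2 = 1 + 2a, the weight exp (- a x^2) turns the normal density at x into the one at s x;
    the factor 1 / s is the Jacobian. This is the one-coordinate case of the rescaling of the
    product measure. *)
Lemma integral_std_normal_preimage_scale (a : R) (B : set R) :
  0 <= a -> measurable B ->
  (\int[std_normal R]_(x in (fun x => Num.sqrt (1 + 2 * a) * x)%R @^-1` B)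
     (expR (- (a * x ^+ 2)))%:E =
   (Num.sqrt (1 + 2 * a))^-1%:E * std_normal R B)%E.
Proof.
move=> a0 mB; set s := Num.sqrt _.
have b0 : 0 < 1 + 2 * a by rewrite ltr_pwDl// mulr_ge0.
have s0 : 0 < s by rewrite sqrtr_gt0.
have s2 : s ^+ 2 = 1 + 2 * a by rewrite sqr_sqrtr// ltW.
have ms : measurable_fun setT (fun x : R => s * x) by exact: measurable_funM.
have mpdf : measurable_fun setT (fun x => (normal_pdf 0 1 x)%:E : \bar R).
  by apply/measurable_EFinP; exact: measurable_normal_pdf.
have mexp : measurable_fun setT (fun x : R => (expR (- (a * x ^+ 2)))%:E).
  apply/measurable_EFinP.
  apply: measurableT_comp => //; apply: measurableT_comp => //.
  by apply: measurable_funM => //; exact: measurable_funX.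
have mpre : measurable ((fun x => s * x) @^-1` B).
  by rewrite -(setTI (_ @^-1` _)); exact: ms.
rewrite integral_mkcond ge0_integral_std_normal; last 2 first.
- by apply/(measurable_restrictT _ _).1 => //; exact: measurable_funTS.
- by move=> x; rewrite patchE; case: ifPn => // _; rewrite lee_fin expR_ge0.
rewrite [in RHS]/std_normal /= /normal_prob [in RHS]integral_mkcond.
rewrite -ge0_integral_lebesgue_scale//; last 2 first.
- by apply/(measurable_restrictT _ _).1 => //; exact: measurable_funTS.
- by move=> x; rewrite patchE; case: ifPn => // _;
  rewrite lee_fin normal_pdf_ge0.
apply: eq_integral => x _; rewrite !patchE.
have -> : (x \in (fun x => s * x) @^-1` B) = (s * x \in B).
  by apply/idP/idP => /set_mem/mem_set.
case: ifPn => _; last by rewrite mule0.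
rewrite -EFinM !normal_pdf01E -mulrA -expRD exprMn s2.
by congr (_ * expR _)%:E; field.
Qed.

End standard_normal.

(** * Polynomials under the Gaussian weight *)

Section gaussian_polynomials.
Context (R : realType).
Local Notation gauss := (std_normal R).
Local Notation lambda := (@lebesgue_measure R).

Lemma exprn_le_expR (x : R) n : 0 <= x -> x ^+ n <= n`!%:R * expR x.
Proof.
move=> x0; case: n => [|n].
  by rewrite expr0 fact0 mul1r -expR0 ler_expR.
rewrite -ler_pdivrMl ?ltr0n ?fact_gt0// mulrC.
by apply: le_trans (expR_ge1Dxn n x0); rewrite lerDr.
Qed.

(** The exponent t^2 / 4 is half of that in the normal density, so one bound yields both
    integrability of polynomials and decay of the boundary terms in integration by parts. *)
Lemma horner_le_gauss (p : {poly R}) :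
  exists2 C, 0 <= C & forall t : R, `|p.[t]| <= C * expR (t ^+ 2 / 4).
Proof.
(* From |t|^i <= 1 + t^(2i) and t^(2i) = 4^i (t^2 / 4)^i <= 4^i i! exp (t^2 / 4). *)
pose c i : R := 1 + 4 ^+ i * i`!%:R.
have c0 i : 0 <= c i by rewrite addr_ge0// mulr_ge0// exprn_ge0.
have cP i (t : R) : `|t| ^+ i <= c i * expR (t ^+ 2 / 4).
  have t0 : 0 <= t ^+ 2 / 4 by rewrite divr_ge0// sqr_ge0.
  have h1 : `|t| ^+ i <= 1 + (t ^+ 2) ^+ i.
    have -> : (t ^+ 2) ^+ i = (`|t| ^+ i) ^+ 2.
      by rewrite -exprM mulnC exprM -normrX real_normK// num_real.
    set u := `|t| ^+ i; have : 0 <= (u - 1) ^+ 2 by exact: sqr_ge0.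
    have u0 : 0 <= u by rewrite exprn_ge0.
    nra.
  have h2 : (t ^+ 2) ^+ i <= 4 ^+ i * (i`!%:R * expR (t ^+ 2 / 4)).
    have -> : (t ^+ 2) ^+ i = 4 ^+ i * (t ^+ 2 / 4) ^+ i.
      by rewrite -exprMn; congr (_ ^+ _); field.
    by rewrite ler_wpM2l ?exprn_ge0// exprn_le_expR.
  have h3 : 1 <= expR (t ^+ 2 / 4) by rewrite -[leLHS]expR0 ler_expR.
  by rewrite /c mulrDl mul1r -mulrA; apply: le_trans h1 _; rewrite lerD.
exists (\sum_(i < size p) `|p`_i| * c i).
  by apply: sumr_ge0 => i _; rewrite mulr_ge0.
move=> t; rewrite horner_coef mulr_suml.
apply: le_trans (ler_norm_sum _ _ _) _; apply: ler_sum => i _.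
by rewrite normrM normrX -mulrA ler_wpM2l.
Qed.

(** The product of exp (t^2 / 4) with the standard normal density is sqrt 2 times the density of
    N(0, 2). *)
Lemma integrable_std_normal_gauss :
  gauss.-integrable setT (fun t : R => (expR (t ^+ 2 / 4))%:E).
Proof.
have mexp : measurable_fun setT (fun t : R => (expR (t ^+ 2 / 4))%:E).
  apply/measurable_EFinP; apply: measurableT_comp => //.
  by apply: measurable_funM => //; exact: measurable_funX.
apply/integrableP; split=> //.
under eq_integral do rewrite abse_EFin ger0_norm ?expR_ge0//.
rewrite ge0_integral_std_normal//.
pose s : R := Num.sqrt 2.
have s0 : 0 < s by rewrite sqrtr_gt0.
have s2 : s ^+ 2 = 2 by rewrite sqr_sqrtr.
have int1 : (\int[lambda]_x (normal_pdf 0 s x)%:E = 1)%E.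
  exact: integral_normal_pdf.
rewrite (_ : (\int[lambda]_x _)%E = s%:E) ?ltry//.
transitivity (\int[lambda]_x (s%:E * (normal_pdf 0 s x)%:E))%E; last first.
  rewrite ge0_integralZl_EFin ?int1 ?mule1 ?(ltW s0)//.
  - by move=> x _; rewrite lee_fin normal_pdf_ge0.
  - by apply/measurable_EFinP; exact: measurable_normal_pdf.
apply: eq_integral => x _; rewrite -!EFinM; congr EFin.
rewrite normal_pdf01E normal_pdfE ?gt_eqF// /normal_fun /normal_peak s2.
rewrite expr1n mul1r -[2 * pi *+ 2]mulrnAr [Num.sqrt (2 * _)]sqrtrM// -/s.
rewrite invfM !mulrA mulfV ?gt_eqF// mul1r -[LHS]mulrA -expRD;
  congr (_ * expR _).
by rewrite subr0; field.
Qed.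

Lemma integrable_horner (p : {poly R}) :
  gauss.-integrable setT (fun t : R => (p.[t])%:E).
Proof.
have [C C0 pC] := horner_le_gauss p.
have := integrableZl measurableT C integrable_std_normal_gauss.
apply: le_integrable => //; first by apply/measurable_EFinP;
  exact: measurable_poly.
by move=> t _; rewrite /= lee_fin; apply: le_trans (pC t) _; rewrite ler_norm.
Qed.

Lemma is_derive_horner (p : {poly R}) (x : R) :
  is_derive x 1 (horner p) (p^`()%R).[x].
Proof.
apply: DeriveDef; first exact: derivable_horner.
by rewrite derivE derive1E.
Qed.

Lemma is_derive_horner_normal_pdf (p : {poly R}) (x : R) :
  is_derive x 1 (fun t => p.[t] * normal_pdf 0 1 t)
    ((p^`()%R - 'X * p).[x] * normal_pdf 0 1 x).
Proof.
(* The exponent of the density is written as a polynomial so that its derivative is a formal one. *)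
pose g : {poly R} := (- 2^-1) *: 'X^2.
have -> : (fun t => p.[t] * normal_pdf 0 1 t) =
    horner p * (normal_peak 1 \*: (expR \o horner g)).
  apply/funext => t; rewrite normal_pdf01E.
  have -> : - t ^+ 2 / 2 = g.[t] by rewrite /g hornerZ hornerXn; field.
  by [].
have dg := is_derive_horner g x.
have dp := is_derive_horner p x.
apply: is_derive_eq.
rewrite /g derivZ derivXn /= normal_pdf01E !(hornerZ, hornerXn, hornerD,
  hornerN, hornerM, hornerX, hornerMn) /GRing.scale /=.
have -> : - x ^+ 2 / 2 = - 2^-1 * x ^+ 2 by field.
by field.
Qed.

Lemma integral_itv_gauss_deriv (p : {poly R}) (a b : R) : a < b ->
  (\int[lambda]_(x in `[a, b]) ((p^`()%R - 'X * p).[x] * normal_pdf 0 1 x)%:E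
   = (p.[b] * normal_pdf 0 1 b - p.[a] * normal_pdf 0 1 a)%:E)%E.
Proof.
move=> ab; pose F t := p.[t] * normal_pdf 0 1 t.
have dF t := is_derive_horner_normal_pdf p t.
have cF : continuous F.
  move=> t; apply/differentiable_continuous/derivable1_diffP.
  exact: (@ex_derive _ _ _ _ _ _ _ (dF t)).
rewrite (@continuous_FTC2 _ _ F)//.
- apply: continuous_subspaceT => t; apply: cvgM.
    exact: continuous_horner.
  exact: continuous_normal_pdf.
- split.
  + by move=> t _; exact: (@ex_derive _ _ _ _ _ _ _ (dF t)).
  + exact/cvg_at_right_filter/cF.
  + exact/cvg_at_left_filter/cF.
- by move=> t _; rewrite derive1E; exact: (@derive_val _ _ _ _ _ _ _ (dF t)).
Qed.

(** The sign [s] selects the end of the real line. After the polynomial is bounded by exp (t^2 / 4),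
    the remaining exp (- n^2 / 4) is at most 1 / (1 + n^2 / 4), hence at most 4 / (n + 1). *)
Lemma horner_normal_pdf_cvg0 (p : {poly R}) (s : R) : `|s| = 1 ->
  p.[s * n%:R] * normal_pdf 0 1 (s * n%:R) @[n --> \oo] --> 0.
Proof.
move=> s1; have [C C0 pC] := horner_le_gauss p.
apply/norm_cvg0P; apply: (@squeeze_cvgr _ _ _ _ (cst 0)
   (fun n => C * normal_peak 1 * 4 * (n.+1%:R)^-1)).
- near=> n; rewrite /cst normr_ge0 /=.
  rewrite normrM normal_pdf01E normrM (ger0_norm (normal_peak_ge0 _)).
  rewrite (ger0_norm (expR_ge0 _)).
  set t := s * n%:R.
  have t2 : t ^+ 2 = n%:R ^+ 2.
    by rewrite -(real_normK (num_real t)) /t normrM s1 mul1r real_normK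
      ?num_real.
  have H : expR (t ^+ 2 / 4) * expR (- t ^+ 2 / 2) <= 4 / n.+1%:R.
    rewrite -expRD.
    have -> : t ^+ 2 / 4 + - t ^+ 2 / 2 = - (t ^+ 2 / 4) by field.
    rewrite expRN -[leRHS]invrK lef_pV2 ?posrE ?expR_gt0 ?invr_gt0 ?divr_gt0//.
    rewrite invf_div t2; apply: le_trans (expR_ge1Dx _).
    rewrite ler_pdivrMr// mulrDl divfK// mul1r -natrX -!natrD ler_nat.
    by rewrite -addn1 addnC -mulnn leq_add//; have [->//|n0] := posnP n;
      rewrite leq_pmulr.
  have peak0 := normal_peak_ge0 (1 : R).
  apply: (@le_trans _ _ (C * expR (t ^+ 2 / 4) *
                         (normal_peak 1 * expR (- t ^+ 2 / 2)))).
    by rewrite ler_wpM2r// mulr_ge0// expR_ge0.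
  by rewrite mulrACA -[leRHS]mulrA ler_wpM2l// mulr_ge0.
- exact: cvg_cst.
- rewrite -[X in _ --> X](mulr0 (C * normal_peak 1 * 4)).
  apply: cvgMr; exact: cvg_harmonic.
Unshelve. all: end_near. Qed.

(** Stein's identity: times the density, the integrand is the derivative of [p] times the density,
    whose boundary values vanish in the limit. The passage from bounded intervals to the line is
    dominated convergence. *)
Lemma integral_gauss_deriv (p : {poly R}) :
  (\int[gauss]_x (p^`()%R - 'X * p).[x]%:E = 0)%E.
Proof.
set q := p^`()%R - 'X * p.
have mpdf : measurable_fun setT (normal_pdf (0 : R) 1) by exact:
  measurable_normal_pdf.
have [iq qE] := @integral_weighted_comp R _ _ _ _ lambda gauss (normal_pdf 0 1)
  id 1
  (normal_pdf_ge0 0 1) mpdf (@measurable_id _ _ setT) ler01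
  (fun A mA => esym (mul1e _)) _ (integrable_horner q).
rewrite mul1e in qE; rewrite -qE.
pose f x : \bar R := ((normal_pdf 0 1 x)%:E * q.[x]%:E)%E.
(* The endpoints use n + 1 because the fundamental theorem of calculus is applied on intervals with
   distinct endpoints. *)
pose I (n : nat) : set R := `[- n.+1%:R, n.+1%:R]%classic.
have mf : measurable_fun setT f by exact: measurable_int iq.
have cvgf : (\int[lambda]_x ((f \_ (I n)) x))%E @[n --> \oo] -->
  (\int[lambda]_x f x)%E.
  have [] // := @dominated_convergence _ _ R lambda setT measurableT
    (fun n => f \_ (I n)) f (abse \o f).
  - move=> n; apply/(measurable_restrictT _ _).1; first exact: measurable_itv.
    exact: measurable_funTS.
  - apply: aeW => x _; apply: cvg_near_cst; near=> n.
    rewrite patchE mem_set// /I /= in_itv/= -ler_norml.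
    apply: (@le_trans _ _ n%:R); last by rewrite ler_nat leqnSn.
    by near: n; exact: nbhs_infty_ger.
  - exact: integrable_abse.
  - by apply: aeW => x n _; rewrite patchE; case: ifPn => _;
    [exact: lexx|rewrite (_ : point = 0%E)// abse0 abse_ge0].
apply: (cvg_unique _ cvgf) => //.
have -> : (fun n => (\int[lambda]_x ((f \_ (I n)) x))%E) =
  (fun n => (p.[n.+1%:R] * normal_pdf 0 1 n.+1%:R -
             p.[- n.+1%:R] * normal_pdf 0 1 (- n.+1%:R))%:E).
  apply/funext => n; rewrite -integral_mkcond -integral_itv_gauss_deriv;
    last first.
    by rewrite -subr_gt0 opprK addr_gt0.
  by apply: eq_integral => x _; rewrite /f -EFinM mulrC.
apply: cvg_EFin; first exact: nearW.
rewrite -[X in _ --> X](subr0 0); apply: cvgB.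
- have := @horner_normal_pdf_cvg0 p 1 (normr1 _).
  under eq_fun do rewrite mul1r.
  by rewrite -cvg_shiftS.
- have := @horner_normal_pdf_cvg0 p (- 1) (etrans (normrN _) (normr1 _)).
  under eq_fun do rewrite mulN1r.
  by rewrite -cvg_shiftS.
Unshelve. all: end_near. Qed.

End gaussian_polynomials.

(** * Hermite polynomials and Mehler's formula *)

Section hermite.
Context (R : realType).
Local Notation gauss := (std_normal R).
Local Notation He := (hermite_monic R).
Local Notation E p := (\int[gauss]_x p.[x]).

Lemma Rintegral_gauss_hornerB (p q : {poly R}) : E (p - q) = E p - E q.
Proof.
rewrite -(RintegralB measurableT (integrable_horner R p) (integrable_horner R
  q)).
by apply: eq_Rintegral => x _; rewrite hornerD hornerN.
Qed.

Lemma Rintegral_gauss_hornerZ (a : R) (p : {poly R}) : E (a *: p) = a * E p.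
Proof.
rewrite -(RintegralZl a measurableT (integrable_horner R p)).
by apply: eq_Rintegral => x _; rewrite hornerZ.
Qed.

(** Stein's identity for [p * q]: the operator p |-> X p - p', which generates the Hermite
    polynomials, is adjoint to differentiation in L^2 of the normal law. *)
Lemma Rintegral_gauss_by_parts (p q : {poly R}) :
  E (('X * p - p^`()%R) * q) = E (p * q^`()%R).
Proof.
have /eqP := congr1 fine (integral_gauss_deriv R (p * q)).
rewrite -[fine _]/(E ((p * q)^`()%R - 'X * (p * q))).
rewrite (_ : _ - _ = p * q^`()%R - ('X * p - p^`()%R) * q).
  by rewrite Rintegral_gauss_hornerB subr_eq0 => /eqP ->.
by rewrite derivM; ring.
Qed.

(** Differentiating the defining recursion gives He_(n+1) plus (n + 1) (X He_n - He_n'), and the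
    bracket is He_(n+1) again. It turns that recursion into the three-term recurrence. *)
Lemma hermite_monic_deriv n : (He n.+1)^`()%R = n.+1%:R *: He n.
Proof.
elim: n => [|n IH].
  by rewrite /= derivC subr0 mulr1 derivX scale1r.
have HeS m : He m.+1 = 'X * He m - (He m)^`()%R by [].
rewrite (HeS n.+1) derivB derivM derivX mul1r IH derivZ -scalerAr -addrA.
by rewrite -scalerBr -HeS -[n.+2]add1n natrD scalerDl scale1r.
Qed.

Lemma hermite_monic_rec n :
  He n.+2 = 'X * He n.+1 - n.+1%:R *: He n.
Proof. by rewrite -hermite_monic_deriv. Qed.

(** Moving the raising operator of one factor onto the other as a derivative produces the factor n +
    1. This identifies the normalisation in [hermite] as sqrt (n!). *)
Lemma Rintegral_hermite_monic_sqr n : \int[gauss]_x ((He n).[x] ^+ 2) = n`!%:R.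
Proof.
have -> : \int[gauss]_x ((He n).[x] ^+ 2) = E (He n * He n).
  by apply: eq_Rintegral => x _; rewrite hornerM.
elim: n => [|n IH].
  rewrite mulr1 fact0 /Rintegral; under eq_integral do rewrite hornerC.
  by rewrite integral_cst// mul1e [X in fine X]probability_setT.
rewrite {1}[He n.+1]/= Rintegral_gauss_by_parts hermite_monic_deriv -scalerAr.
by rewrite Rintegral_gauss_hornerZ IH -natrM factS.
Qed.

Lemma hermiteE n (x : R) : hermite n x = (He n).[x] / Num.sqrt n`!%:R.
Proof. by rewrite /hermite Rintegral_hermite_monic_sqr. Qed.

(** At equal degrees the square roots of the normalisation multiply to n!, so the Mehler
    coefficients become rational expressions within reach of [field]. *)
Lemma hermite_mul n (x y : R) :
  hermite n x * hermite n y = (He n).[x] * (He n).[y] / n`!%:R.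
Proof.
rewrite !hermiteE mulrACA -invfM -expr2 sqr_sqrtr//.
Qed.
End hermite.

(** * Power series with radius of convergence at least one *)

Section power_series.
Context (R : realType).
Implicit Types (c : R^nat) (t K l : R).

(** Encodes a radius of convergence of at least 1 by boundedness of the terms at every radius below
    1, a form that passes easily to the formal derivative. *)
Definition unit_disc_bounded c :=
  forall K, 0 <= K -> K < 1 -> exists C, forall n, `|c n| * K ^+ n <= C.

(** Boundedness at a radius [K] halfway between |t| and 1 gives comparison with a geometric series
    of ratio |t| / K. *)
Lemma unit_disc_bounded_cvg c t : unit_disc_bounded c -> `|t| < 1 ->
  cvgn (pseries c t).
Proof.
move=> bc t1; pose K : R := (1 + `|t|) / 2.
have K0 : 0 < K by rewrite divr_gt0// ltr_pwDl.
have K1 : K < 1 by rewrite /K; lra.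
have tK : `|t| < K by rewrite /K; lra.
have [C bC] := bc K (ltW K0) K1.
apply: normed_cvg; apply: (@series_le_cvg _ _ (geometric C (`|t| / K))) => //.
- by move=> n; exact: normr_ge0.
- move=> n; rewrite /geometric /= mulr_ge0 ?exprn_ge0 ?divr_ge0 ?(ltW K0)//.
  by rewrite (le_trans _ (bC 0%N))// mulr_ge0.
- move=> n; rewrite /geometric /= normrM normrX expr_div_n mulrA.
  by rewrite ler_pdivlMr ?exprn_gt0// mulrAC ler_wpM2r ?exprn_ge0.
- apply: is_cvg_geometric_series.
  by rewrite ger0_norm ?divr_ge0 ?(ltW K0)// ltr_pdivrMr// mul1r.
Qed.

Lemma bernoulli_ineq (d : R) n : 0 <= d -> 1 + n%:R * d <= (1 + d) ^+ n.
Proof.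
move=> d0; elim: n => [|n IH]; first by rewrite mul0r addr0 expr0.
rewrite exprS; apply: (@le_trans _ _ ((1 + d) * (1 + n%:R * d))).
  have : 0 <= n%:R * d * d by rewrite !mulr_ge0.
  rewrite -natr1; nra.
by rewrite ler_wpM2l// addr_ge0.
Qed.

(** The factor n + 1 produced by differentiation is absorbed by a slightly larger radius [K']:
    Bernoulli's inequality bounds it by (1 + 1/d) (1 + d)^n. *)
Lemma unit_disc_bounded_diffs c :
  unit_disc_bounded c -> unit_disc_bounded (pseries_diffs c).
Proof.
move=> bc K K0 K1; pose K' : R := (1 + K) / 2.
have K'0 : 0 < K' by rewrite divr_gt0// ltr_pwDl.
have K'1 : K' < 1 by rewrite /K'; lra.
have [C bC] := bc K' (ltW K'0) K'1.
(* With this [d], the inequality K (1 + d) <= K' amounts to (1 - K)^2 >= 0. *)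
pose d : R := (1 - K) / 2.
have d0 : 0 < d by rewrite /d; lra.
have Kd : K * (1 + d) <= K' by rewrite /d /K'; nra.
have C0 : 0 <= C by apply: le_trans (bC 0%N); rewrite mulr_ge0.
exists (C / K' * (1 + d^-1)) => n.
rewrite /pseries_diffs normrM ger0_norm//.
have h1 : n.+1%:R <= (1 + d^-1) * (1 + d) ^+ n.
  apply: (@le_trans _ _ ((1 + d^-1) * (1 + n%:R * d))).
    have e : d^-1 * (n%:R * d) = n%:R by rewrite mulrCA mulVf ?gt_eqF// mulr1.
    rewrite mulrDl mul1r mulrDr mulr1 e -natr1.
    have : 0 <= n%:R * d by rewrite mulr_ge0// ltW.
    have : 0 <= d^-1 by rewrite invr_ge0 ltW.
    lra.
  by rewrite ler_wpM2l ?bernoulli_ineq ?(ltW d0)// addr_ge0// invr_ge0 ltW.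
have h2 : (1 + d) ^+ n * K ^+ n <= K' ^+ n.
  by rewrite -exprMn lerXn2r ?nnegrE ?mulr_ge0 ?addr_ge0 ?(ltW d0) ?(ltW K'0)//
    mulrC.
have h3 : `|c n.+1| * K' ^+ n <= C / K'.
  by rewrite ler_pdivlMr// -mulrA -exprSr.
apply: (@le_trans _ _ ((1 + d^-1) * (1 + d) ^+ n * `|c n.+1| * K ^+ n)).
  by rewrite !ler_wpM2r// exprn_ge0.
rewrite -2!mulrA [leRHS]mulrC ler_wpM2l//.
  by rewrite addr_ge0// invr_ge0 ltW.
by apply: le_trans h3; rewrite mulrCA ler_wpM2l.
Qed.

Definition shift_coef c : R^nat := fun n => if n is m.+1 then c m else 0.

Lemma cvg_pseries_shift c t l : pseries c t @ \oo --> l ->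
  pseries (shift_coef c) t @ \oo --> t * l.
Proof.
move=> cl; rewrite -cvg_shiftS.
rewrite (_ : [sequence pseries (shift_coef c) t n.+1]_n = (fun n => t * pseries
  c t n)).
  by apply: cvgMr.
apply/funext => n /=; rewrite /pseries /series /= big_nat_recl//= mul0r add0r.
by rewrite mulr_sumr; apply: eq_bigr => i _; rewrite exprS mulrCA.
Qed.

Lemma cvg_pseriesD c1 c2 t l1 l2 :
  pseries c1 t @ \oo --> l1 -> pseries c2 t @ \oo --> l2 ->
  pseries (fun n => c1 n + c2 n) t @ \oo --> l1 + l2.
Proof.
move=> c1l c2l; rewrite (_ : pseries _ t = (fun n => pseries c1 t n + pseries
  c2 t n)).
  exact: cvgD.
apply/funext => n; rewrite /pseries /series /= -big_split.
by apply: eq_bigr => i _; rewrite mulrDl.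
Qed.

Lemma cvg_pseriesZ k c t l : pseries c t @ \oo --> l ->
  pseries (fun n => k * c n) t @ \oo --> k * l.
Proof.
move=> cl; rewrite (_ : pseries _ t = (fun n => k * pseries c t n)).
  exact: cvgMr.
apply/funext => n; rewrite /pseries /series /= mulr_sumr.
by apply: eq_bigr => i _; rewrite mulrA.
Qed.
End power_series.

(** * The coefficients of the Mehler series *)

Section mehler.
Context (R : realType).
Local Notation He := (hermite_monic R).
Implicit Types (x y t : R).

Lemma hermite_rec n x : hermite n.+2 x =
  x / Num.sqrt n.+2%:R * hermite n.+1 x
  - Num.sqrt (n.+1%:R / n.+2%:R) * hermite n x.
Proof.
rewrite !hermiteE hermite_monic_rec hornerD hornerN hornerM hornerX hornerZ.
have f0 : 0 < Num.sqrt (n`!%:R : R) by rewrite sqrtr_gt0 ltr0n fact_gt0.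
have s1 : 0 < Num.sqrt (n.+1%:R : R) by rewrite sqrtr_gt0.
have s2 : 0 < Num.sqrt (n.+2%:R : R) by rewrite sqrtr_gt0.
rewrite !factS !natrM !sqrtrM// sqrtrV//.
set u := Num.sqrt n.+1%:R in s1 *; set v := Num.sqrt n.+2%:R in s2 *.
set f := Num.sqrt n`!%:R in f0 *.
have -> : n.+1%:R = u ^+ 2 by rewrite sqr_sqrtr.
by field; rewrite !gt_eqF.
Qed.

(** In the normalised recurrence the coefficient of h_(n+1) tends to 0 and that of h_n is at most 1.
    Once the former is at most d, growth by 1 + d per step persists because d (1 + d) + 1 <= (1 +
    d)^2; [C] takes care of the finitely many earlier values. *)
Lemma hermite_subexponential x (d : R) : 0 < d ->
  exists C, forall n, `|hermite n x| <= C * (1 + d) ^+ n.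
Proof.
move=> d0.
have [N _ xN] : \forall n \near \oo, `|x| / Num.sqrt n.+2%:R <= d.
  near=> n; rewrite ler_pdivrMr ?sqrtr_gt0// mulrC -ler_pdivrMr//.
  rewrite -(@ler_sqr _ _ (Num.sqrt _)) ?nnegrE ?divr_ge0 ?(ltW d0) ?sqrtr_ge0//.
  rewrite sqr_sqrtr//; apply: (@le_trans _ _ n%:R).
    by near: n; exact: nbhs_infty_ger.
  by rewrite ler_nat -addn2 leq_addr.
pose C : R := \sum_(i < N.+2) `|hermite i x|.
have d1 : 1 <= 1 + d by rewrite lerDl ltW.
have small n : (n < N.+2)%N -> `|hermite n x| <= C * (1 + d) ^+ n.
  move=> nN; apply: (@le_trans _ _ C).
    by rewrite /C (bigD1 (Ordinal nN))//= lerDl sumr_ge0.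
  by rewrite ler_peMr ?exprn_ege1// sumr_ge0.
exists C => n.
suff: `|hermite n x| <= C * (1 + d) ^+ n /\
      `|hermite n.+1 x| <= C * (1 + d) ^+ n.+1 by case.
elim: n => [|n [IH1 IH2]]; first by split; exact: small.
split=> //; have [nN|Nn] := ltnP n.+2 N.+2; first exact: small.
rewrite hermite_rec.
have x1 : `|x / Num.sqrt n.+2%:R| <= d.
  by rewrite normrM normfV (ger0_norm (sqrtr_ge0 _)); apply: xN;
    rewrite /= -2!ltnS.
have x2 : `|Num.sqrt (n.+1%:R / n.+2%:R : R)| <= 1.
  rewrite ger0_norm ?sqrtr_ge0// -[leRHS]sqrtr1 ler_wsqrtr//.
  by rewrite ler_pdivrMr// mul1r ler_nat.
apply: le_trans (ler_normB _ _) _.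
rewrite [`|_ * hermite n.+1 x|]normrM [`|_ * hermite n x|]normrM.
apply: (@le_trans _ _ (d * (C * (1 + d) ^+ n.+1) + 1 * (C * (1 + d) ^+ n))).
  by apply: lerD; apply: ler_pM.
have : 0 <= C * (1 + d) ^+ n.
  by rewrite mulr_ge0 ?sumr_ge0// exprn_ge0// ltW// (lt_le_trans ltr01).
by rewrite !exprS; set w := _ ^+ n; nra.
Unshelve. all: end_near. Qed.

Definition mehler_coef x y : R^nat := fun n => hermite n x * hermite n y.

Lemma mehler_coef_bounded x y : unit_disc_bounded R (mehler_coef x y).
Proof.
(* Chosen so that (1 + d)^2 K <= 1: the growth of the two Hermite factors is compensated by K^n. *)
move=> K K0 K1; pose d : R := (1 - K) / 4.
have d0 : 0 < d by rewrite /d; lra.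
have [Cx bndx] := hermite_subexponential x d d0.
have [Cy bndy] := hermite_subexponential y d d0.
have KC : (1 + d) * (1 + d) * K <= 1 by rewrite /d; nra.
have d1 : 0 <= 1 + d by rewrite addr_ge0// ltW.
have Cx0 : 0 <= Cx.
  by have := le_trans (normr_ge0 _) (bndx 0%N); rewrite expr0 mulr1.
have Cy0 : 0 <= Cy.
  by have := le_trans (normr_ge0 _) (bndy 0%N); rewrite expr0 mulr1.
exists (Cx * Cy) => n; rewrite /mehler_coef normrM.
apply: (@le_trans _ _ (Cx * (1 + d) ^+ n * (Cy * (1 + d) ^+ n) * K ^+ n)).
  by rewrite ler_wpM2r ?exprn_ge0// ler_pM.
rewrite mulrACA -[leLHS]mulrA ler_piMr ?mulr_ge0// -!exprMn exprn_ile1//.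
by rewrite !mulr_ge0.
Qed.

(* With [p_k] and [q_k] five consecutive monic Hermite values at [x] and [y],
   starting at degree [v + 1], and [f = (v + 1)!]. *)
Lemma mehler_coef_rec_generic x y (v f p0 p1 q0 q1 : R) :
  f != 0 -> v + 2 != 0 -> v + 3 != 0 -> v + 4 != 0 -> v + 5 != 0 ->
  let p2 := x * p1 - (v + 2) * p0 in let q2 := y * q1 - (v + 2) * q0 in
  let p3 := x * p2 - (v + 3) * p1 in let q3 := y * q2 - (v + 3) * q1 in
  let p4 := x * p3 - (v + 4) * p2 in let q4 := y * q3 - (v + 4) * q2 in
  (v + 5) * (p4 * q4 / ((v + 5) * ((v + 4) * ((v + 3) * ((v + 2) * f)))))
  - 2 * ((v + 3) * (p2 * q2 / ((v + 3) * ((v + 2) * f))))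
  + (v + 1) * (p0 * q0 / f) =
  p2 * q2 / ((v + 3) * ((v + 2) * f)) - p0 * q0 / f
  + x * y * (p3 * q3 / ((v + 4) * ((v + 3) * ((v + 2) * f)))
             + p1 * q1 / ((v + 2) * f))
  - (x ^+ 2 + y ^+ 2) * (p2 * q2 / ((v + 3) * ((v + 2) * f))).
Proof.
move=> f0 v2 v3 v4 v5 p2 q2 p3 q3 p4 q4; rewrite /p4 /q4 /p3 /q3 /p2 /q2.
by field; rewrite v2 v3 v4 v5 f0.
Qed.

(* The differential equation of [mehler_ode], coefficient by coefficient:
   [s] multiplies a power series by the variable. *)
Lemma mehler_coef_rec x y n : let a := mehler_coef x y in
  let s := shift_coef R in
  pseries_diffs a n - 2 * s (s (pseries_diffs a)) n
    + s (s (s (s (pseries_diffs a)))) n =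
  s a n - s (s (s a)) n + x * y * (a n + s (s a) n) - (x ^+ 2 + y ^+ 2) * s a n.
Proof.
have He2 (z : R) k : (He k.+2).[z] = z * (He k.+1).[z] - k.+1%:R * (He k).[z].
  by rewrite hermite_monic_rec hornerD hornerN hornerM hornerX hornerZ.
have He0 z : (He 0).[z] = 1 by rewrite hornerC.
have He1 z : (He 1).[z] = z by rewrite /= mulr1 derivC subr0 hornerX.
have f0 (k : nat) : k`!%:R != 0 :> R by rewrite pnatr_eq0 -lt0n fact_gt0.
have aE k : mehler_coef x y k = (He k).[x] * (He k).[y] / k`!%:R.
  exact: hermite_mul.
rewrite /= /pseries_diffs /shift_coef.
move: (mehler_coef x y) aE => a aE.
have a0 : a 0%N = 1 by rewrite aE !He0 (_ : 0`! = 1%N)// divr1 mulr1.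
have a1 : a 1%N = x * y by rewrite aE !He1 (_ : 1`! = 1%N)// divr1.
have a2 : a 2%N = (x ^+ 2 - 1) * (y ^+ 2 - 1) / 2.
  by rewrite aE !He2 !He1 !He0 (_ : 2`! = 2%N)//; congr (_ * _ / _); ring.
have a3 : a 3%N = (x ^+ 3 - 3 * x) * (y ^+ 3 - 3 * y) / 6.
  by rewrite aE !He2 !He1 !He0 (_ : 3`! = 6%N)//; congr (_ * _ / _); ring.
have a4 : a 4%N = (x ^+ 4 - 6 * x ^+ 2 + 3) * (y ^+ 4 - 6 * y ^+ 2 + 3) / 24.
  by rewrite aE !He2 !He1 !He0 (_ : 4`! = 24%N)//; congr (_ * _ / _); ring.
(* The equation involves up to four shifts. For n < 4 some shifted coefficients are the default 0 of
   [shift_coef], so these cases use explicit values; beyond them the generic recurrence applies. *)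
case: n => [|[|[|[|n]]]].
- by rewrite a0 a1; ring.
- by rewrite a0 a1 a2; lra.
- by rewrite a0 a1 a2 a3; lra.
- by rewrite a0 a1 a2 a3 a4; lra.
rewrite !aE {a0 a1 a2 a3 a4 aE a}.
have nk k : n%:R + k.+1%:R != 0 :> R by rewrite -natrD pnatr_eq0 addnS.
have := @mehler_coef_rec_generic x y n%:R n.+1`!%:R
  (He n.+1).[x] (He n.+2).[x] (He n.+1).[y] (He n.+2).[y]
  (f0 _) (nk 1%N) (nk 2%N) (nk 3%N) (nk 4%N).
have nE k : n%:R + k%:R = (n + k)%:R :> R by rewrite natrD.
cbv zeta; rewrite natr1 !nE !addnS addn0 -!natrM -!factS -!He2; exact.
Qed.
End mehler.

(** * Summation of the Mehler series *)

Section mehler_formula.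
Context (R : realType).
Implicit Types (x y t : R).

(** The two sides are the limits of power series in t whose coefficients agree by [mehler_coef_rec];
    each shift of coefficients contributes a factor t to the limit. *)
Lemma mehler_ode x y t : `|t| < 1 ->
  (1 - t ^+ 2) ^+ 2 * limn (pseries (pseries_diffs (mehler_coef R x y)) t) =
  (t * (1 - t ^+ 2) + x * y * (1 + t ^+ 2) - (x ^+ 2 + y ^+ 2) * t) *
  limn (pseries (mehler_coef R x y) t).
Proof.
move=> t1; have ba := mehler_coef_bounded R x y.
have al := unit_disc_bounded_cvg _ _ _ ba t1.
have dl := unit_disc_bounded_cvg _ _ _ (unit_disc_bounded_diffs _ _ ba) t1.
have rec := mehler_coef_rec R x y.
move: (mehler_coef R x y) rec al dl {ba} => a; cbv zeta.
set d := pseries_diffs a; set l := limn (pseries a t).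
set l' := limn (pseries d t) => rec; rewrite -/l -/l' => al dl.
have sh c m : pseries c t @ \oo --> m ->
  pseries (shift_coef R c) t @ \oo --> t * m := @cvg_pseries_shift R c t m.
have add c1 c2 m1 m2 := @cvg_pseriesD R c1 c2 t m1 m2.
have scal k c m := @cvg_pseriesZ R k c t m.
have lhs := add _ _ _ _ (add _ _ _ _ dl (scal (- 2) _ _ (sh _ _ (sh _ _ dl))))
  (sh _ _ (sh _ _ (sh _ _ (sh _ _ dl)))).
have rhs := add _ _ _ _ (add _ _ _ _ (add _ _ _ _ (sh _ _ al)
  (scal (- 1) _ _ (sh _ _ (sh _ _ (sh _ _ al)))))
  (scal (x * y) _ _ (add _ _ _ _ al (sh _ _ (sh _ _ al)))))
  (scal (- (x ^+ 2 + y ^+ 2)) _ _ (sh _ _ al)).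
have E : (fun n => d n + - 2 * shift_coef R (shift_coef R d) n +
    shift_coef R (shift_coef R (shift_coef R (shift_coef R d))) n) =
  (fun n => shift_coef R a n +
    - 1 * shift_coef R (shift_coef R (shift_coef R a)) n +
    x * y * (a n + shift_coef R (shift_coef R a) n) +
    - (x ^+ 2 + y ^+ 2) * shift_coef R a n).
  by apply/funext => n; rewrite !mulNr mul1r; exact: rec.
rewrite E in lhs; have eq_l := cvg_unique (@norm_hausdorff _ R) lhs rhs.
transitivity (l' + - 2 * (t * (t * l')) + t * (t * (t * (t * l')))).
  by ring.
by rewrite eq_l; ring.
Qed.

(** For |t| < 1 this is the density of the bivariate normal law with standard margins and
    correlation t, relative to the product of its margins. *)
Definition mehler_kernel (t x y : R) : R :=
  expR ((2 * t * (x * y) - t ^+ 2 * (x ^+ 2 + y ^+ 2)) / (2 * (1 - t ^+ 2))) /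
  Num.sqrt (1 - t ^+ 2).

Lemma is_derive_mehler_sum x y t : `|t| < 1 ->
  is_derive t 1 (fun s => limn (pseries (mehler_coef R x y) s))
    (limn (pseries (pseries_diffs (mehler_coef R x y)) t)).
Proof.
move=> t1; have b0 := mehler_coef_bounded R x y.
have b1 := unit_disc_bounded_diffs _ _ b0.
have b2 := unit_disc_bounded_diffs _ _ b1.
(* Termwise differentiation at t is justified by convergence of the series and of its first two
   formal derivatives at a point strictly beyond |t|. *)
pose K : R := (1 + `|t|) / 2.
have t0 : 0 <= `|t| by [].
have K0 : 0 <= K by rewrite /K; lra.
have K1 : `|K| < 1 by rewrite ger0_norm// /K; lra.
apply: (@pseries_snd_diffs _ _ K); try exact: unit_disc_bounded_cvg.
by rewrite (ger0_norm K0) /K; lra.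
Qed.

(** The differentiated function is the reciprocal of [mehler_kernel]. Its logarithmic derivative is
    the negative of the one prescribed by [mehler_ode], so it is an integrating factor. *)
Lemma is_derive_mehler_weight x y t : `|t| < 1 ->
  is_derive t 1
    (fun s => expR (- ((2 * s * (x * y) - s ^+ 2 * (x ^+ 2 + y ^+ 2)) /
                      (2 * (1 - s ^+ 2)))) * Num.sqrt (1 - s ^+ 2))
    (- (t * (1 - t ^+ 2) + x * y * (1 + t ^+ 2) - (x ^+ 2 + y ^+ 2) * t)
       / (1 - t ^+ 2) ^+ 2 *
     (expR (- ((2 * t * (x * y) - t ^+ 2 * (x ^+ 2 + y ^+ 2)) /
              (2 * (1 - t ^+ 2)))) * Num.sqrt (1 - t ^+ 2))).
Proof.
move=> t1.
have v0 : 0 < 1 - t ^+ 2.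
  by rewrite subr_gt0 -(real_normK (num_real t)) exprn_ilt1.
pose p : {poly R} := (2 * (x * y)) *: 'X - (x ^+ 2 + y ^+ 2) *: 'X^2.
pose q : {poly R} := 1 - 'X^2.
have pE s : p.[s] = 2 * s * (x * y) - s ^+ 2 * (x ^+ 2 + y ^+ 2).
  by rewrite /p hornerD hornerN !hornerZ hornerX hornerXn; ring.
have qE s : q.[s] = 1 - s ^+ 2 by rewrite /q hornerD hornerN hornerC hornerXn.
have p'E : (p^`()%R).[t] = 2 * (x * y) - (x ^+ 2 + y ^+ 2) * (2 * t).
  rewrite /p derivB !derivZ derivX derivXn hornerD hornerN !hornerZ hornerC.
  by rewrite hornerMn hornerX; ring.
have q'E : (q^`()%R).[t] = - (2 * t).
  by rewrite /q derivB derivC derivXn hornerD hornerN hornerC hornerMn hornerX;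
    ring.
have dp := is_derive_horner R p t.
have dq := is_derive_horner R q t.
have q0 : q.[t] != 0 by rewrite qE gt_eqF.
have dqV := is_deriveV q0 dq.
have dr := is_deriveM dp dqV.
pose g (s : R) : R := - (2^-1 * (p.[s] * (q.[s])^-1)).
have dg : is_derive t 1 g _ := is_deriveN (is_deriveZ 2^-1 dr).
have de := @is_derive1_comp R expR g t _ _ (is_derive_expR (g t)) dg.
have sq : 0 < q.[t] by rewrite qE.
have ds := @is_derive1_comp R Num.sqrt (horner q) t _ _ (is_derive1_sqrt sq) dq.
have := is_deriveM de ds.
rewrite [X in is_derive _ _ X _ -> _](_ : _ = fun s => expR
    (- ((2 * s * (x * y) - s ^+ 2 * (x ^+ 2 + y ^+ 2)) /
        (2 * (1 - s ^+ 2)))) * Num.sqrt (1 - s ^+ 2)); last first.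
  apply/funext => s; rewrite -[LHS]/(expR (g s) * Num.sqrt q.[s]) qE.
  by rewrite /g pE qE [in RHS]invfM mulrCA.
move=> /is_derive_eq; apply.
rewrite /GRing.scale /= -/(g t) p'E q'E /g pE qE.
rewrite (_ : _ / (2 * (1 - t ^+ 2)) = 2^-1 * ((2 * t * (x * y) - t ^+ 2 *
  (x ^+ 2 + y ^+ 2)) / (1 - t ^+ 2))); last by rewrite invfM mulrCA.
set e := expR _; set w := Num.sqrt _.
have w0 : w != 0 by rewrite gt_eqF// sqrtr_gt0.
(* Moves the square root to the numerator, so that both sides are linear in [w] and [field] need not
   know its square. *)
have -> : (2 * w)^-1 = w / (2 * (1 - t ^+ 2)).
  by rewrite -[1 - _](@sqr_sqrtr R _ (ltW v0)) -/w; field.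
by field; rewrite gt_eqF.
Qed.

(** No uniqueness theorem for differential equations is needed: the series [S] times the integrating
    factor [W] has derivative 0 on [0, t], and the mean value theorem identifies it with its value 1
    at 0. *)
Lemma mehler_formula x y t : 0 <= t -> t < 1 ->
  limn (pseries (mehler_coef R x y) t) = mehler_kernel t x y.
Proof.
move=> t0 t1; set S := fun s => limn (pseries (mehler_coef R x y) s).
pose W s := expR (- ((2 * s * (x * y) - s ^+ 2 * (x ^+ 2 + y ^+ 2)) /
                    (2 * (1 - s ^+ 2)))) * Num.sqrt (1 - s ^+ 2).
have W0 : 0 < W t.
  rewrite mulr_gt0 ?expR_gt0// sqrtr_gt0 subr_gt0 exprn_ilt1//.
suff SW : S t * W t = 1.
  rewrite -[LHS](mulfK (lt0r_neq0 W0)) -/(S t) SW mul1r /mehler_kernel /W invfM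
    expRN.
  by rewrite invrK.
have dSW (s : R) : `|s| < 1 -> is_derive s (1 : R) (fun u : R => S u * W u) (0
  : R).
  move=> s1; have := is_deriveM (is_derive_mehler_sum x y s s1)
    (is_derive_mehler_weight x y s s1).
  move=> /is_derive_eq; apply; rewrite /GRing.scale /=.
  rewrite -/(W s) -/(S s); have := mehler_ode x y s s1.
  rewrite -/(S s); set l := limn _; set c := _ + _ - _ => ode.
  have v0 : 1 - s ^+ 2 != 0.
    by rewrite gt_eqF// subr_gt0 -(real_normK (num_real s)) exprn_ilt1.
  have -> : l = c * S s / (1 - s ^+ 2) ^+ 2.
    by rewrite -ode mulrC mulKf// expf_neq0.
  by field.
have S0 : S 0 = 1.
  rewrite /S; apply: cvg_lim => //; rewrite -cvg_shiftS.
  rewrite (_ : [sequence _]_n = cst 1); first exact: cvg_cst.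
  apply/funext => n; rewrite /pseries /series /= big_nat_recl//= expr0 mulr1.
  rewrite big1_seq ?addr0; last by move=> i _; rewrite expr0n mulr0.
  by rewrite /mehler_coef hermite_mul !hornerC (_ : 0`! = 1%N)// divr1 mulr1.
have seg s : s \in `[0, t]%R -> `|s| < 1.
  by rewrite in_itv/= => /andP[s0 st]; rewrite ger0_norm//;
    apply: le_lt_trans t1.
have cSW : {within `[0, t], continuous (fun u => S u * W u)}.
  apply: derivable_within_continuous => s st.
  exact: (@ex_derive _ _ _ _ _ _ _ (dSW s (seg s st))).
have dSWt s (st : s \in `]0, t[%R) := dSW s (seg s (subset_itv_oo_cc st)).
have [c _ /eqP] := MVT_segment t0 dSWt cSW.
rewrite mul0r subr_eq0 => /eqP ->.
rewrite S0 mul1r /W expr0n /= mulr0 !mul0r subrr mul0r oppr0 expR0 mul1r addr0.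
exact: sqrtr1.
Qed.
End mehler_formula.

(** * Products over the index set *)

Section index_enumeration.
Context (R : realType) (D : index_kind).
Implicit Types (a u : indices D -> R) (n m : nat).

(* For finite [J] this is all of [J] whatever [n], so that both cases of [prodJ]
   are limits of partial products. *)
Definition initial_indices n : seq (indices D) :=
  match D return seq (indices D) with
  | FiniteIndices d => enum 'I_d
  | CountableIndices => iota 0 n
  end.

Definition partial_prod a n : R := \prod_(j <- initial_indices n) a j.

Lemma prodJE a : prodJ a = limn (partial_prod a).
Proof.
rewrite /partial_prod /initial_indices.
case: D a => [d|] a /=.
  by rewrite big_enum; apply/esym/lim_cst.
rewrite (_ : (fun n => \prod_(j <- iota 0 n) a j) = (fun n => \prod_(j < n) a
  j))//.
by apply/funext => n; rewrite -(big_mkord predT) /index_iota subn0.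
Qed.

Lemma initial_indices_uniq n : uniq (initial_indices n).
Proof.
by rewrite /initial_indices; case: D => [d|] /=;
  [exact: enum_uniq|exact: iota_uniq].
Qed.

Lemma initial_indices_cat n m : (n <= m)%N ->
  exists r, initial_indices m = initial_indices n ++ r.
Proof.
move=> nm; rewrite /initial_indices; case: D => [d|] /=.
  by exists [::]; rewrite cats0.
by exists (iota n (m - n)); rewrite -{1}(subnKC nm) iotaD add0n.
Qed.

Lemma initial_indices_sub (s : seq (indices D)) :
  \forall n \near \oo, {subset s <= initial_indices n}.
Proof.
rewrite /initial_indices; case: D s => [d|] s /=.
  by apply: nearW => n j _; rewrite mem_enum.
exists (\max_(j <- s) j).+1 => // n /= sn j js; rewrite mem_iota add0n /=.
by apply: leq_trans sn; rewrite ltnS; exact: leq_bigmax_seq.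
Qed.

(** Every finite set of indices lies in some [initial_indices], so for nonnegative terms a bound on
    these sums bounds all finite sums, whose supremum defines [esum]. *)
Lemma sumJ_finiteP a : (forall j, 0 <= a j) ->
  sumJ_finite a <-> exists C, forall n, \sum_(j <- initial_indices n) a j <= C.
Proof.
move=> a0; split=> [fin_a|[C aC]].
  have s0 : (0 <= \esum_(j in [set: indices D]) (a j)%:E)%E.
    by apply: esum_ge0 => j _; rewrite lee_fin.
  exists (fine (\esum_(j in [set: indices D]) (a j)%:E)%E) => n.
  rewrite -lee_fin fineK ?ge0_fin_numE//.
  apply: esum_ge; exists [set` initial_indices n].
    by split => //; exact: finite_seq.
  by rewrite -fsbig_seq ?initial_indices_uniq// sumEFin.
apply: (@le_lt_trans _ _ C%:E); last exact: ltry.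
apply: ge_ereal_sup => _ [A [/finite_seqP[s0 ->] _] <-].
pose s := undup s0.
have -> : [set` s0] = [set` s] by apply/seteqP; split => j /=;
  rewrite mem_undup.
have us : uniq s by exact: undup_uniq.
have [N _ sN] := initial_indices_sub s.
have {}sN := sN N (leqnn N).
rewrite -fsbig_seq// sumEFin lee_fin; apply: le_trans (aC N).
rewrite [leRHS](bigID (mem s))/= -[leLHS]addr0 lerD//; last by apply: sumr_ge0.
rewrite -[leRHS]big_filter le_eqVlt; apply/orP; left; apply/eqP.
apply: perm_big; apply: uniq_perm; rewrite ?filter_uniq ?initial_indices_uniq//.
by move=> j; rewrite mem_filter; apply/idP/andP => [js|[]//]; split=> //;
  exact: sN.
Qed.

Lemma partial_prod_nonincreasing a : (forall j, 0 <= a j <= 1) ->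
  nonincreasing_seq (partial_prod a).
Proof.
move=> a01 n m nm; rewrite /partial_prod.
have [r ->] := initial_indices_cat _ _ nm; rewrite big_cat /=.
rewrite ler_piMr ?prodr_ge0//; first by move=> j _; have /andP[] := a01 j.
by apply: prodr_ile1 => j _; exact: a01.
Qed.

Lemma partial_prod_itv a n : (forall j, 0 <= a j <= 1) -> 0 <= partial_prod a n
  <= 1.
Proof.
move=> a01; rewrite prodr_ge0 /=; last by move=> j _; have /andP[] := a01 j.
by apply: prodr_ile1 => j _; exact: a01.
Qed.

(** [prodJ] is a [limn], informative only if the partial products converge. Factors in [0, 1] make
    them decreasing and bounded below; the limit may be 0. *)
Lemma cvg_partial_prod a : (forall j, 0 <= a j <= 1) ->
  partial_prod a n @[n --> \oo] --> prodJ a.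
Proof.
move=> a01; rewrite prodJE; apply: nonincreasing_is_cvgn.
  exact: partial_prod_nonincreasing.
by exists 0 => _ [n _ <-]; have /andP[] := partial_prod_itv _ n a01.
Qed.

Lemma prodJ_itv a : (forall j, 0 <= a j <= 1) -> 0 <= prodJ a <= 1.
Proof.
move=> a01; have cvg_a := cvg_partial_prod _ a01.
rewrite -(cvg_lim _ cvg_a)//; apply/andP; split.
  apply: limr_ge; first exact: cvgP cvg_a.
  by apply: nearW => n; have /andP[] := partial_prod_itv _ n a01.
apply: limr_le; first exact: cvgP cvg_a.
by apply: nearW => n; have /andP[] := partial_prod_itv _ n a01.
Qed.

(** The partial products stay above exp (- C), where C bounds the partial sums of [u]. *)
Lemma prodJ_gt0 a u : (forall j, 0 <= u j) -> sumJ_finite u ->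
  (forall j, expR (- u j) <= a j <= 1) -> 0 < prodJ a.
Proof.
move=> u0 /(sumJ_finiteP _ u0)[C uC] ua.
have a01 j : 0 <= a j <= 1.
  by have /andP[ua0 ->] := ua j; rewrite (le_trans _ ua0)// expR_ge0.
have cvg_a := cvg_partial_prod _ a01.
apply: (@lt_le_trans _ _ (expR (- C))); first exact: expR_gt0.
rewrite -(cvg_lim _ cvg_a)//; apply: limr_ge; first exact: cvgP cvg_a.
apply: nearW => n; apply: (@le_trans _ _ (expR (- \sum_(j <- initial_indices n)
  u j))).
  by rewrite ler_expR lerN2.
rewrite -sumrN expR_sum; apply: ler_prod => j _.
by rewrite expR_ge0 /=; have /andP[] := ua j.
Qed.

End index_enumeration.

(** * The Gaussian product measure *)

Section sequence_space.
Context (R : realType) (D : index_kind).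
Local Notation T := (RJ R D).

Definition cylinder (s : seq (indices D)) (B : indices D -> set R) : set T :=
  [set x : T | forall j, j \in s -> B j (x j)].

Lemma measurable_coord (j : indices D) : measurable_fun setT (fun x : T => x j).
Proof.
move=> _ B mB; rewrite setTI; apply: sub_sigma_algebra.
by exists j; exists B.
Qed.

Lemma measurable_cylinder s B : (forall j, measurable (B j)) ->
  measurable (cylinder s B).
Proof.
move=> mB; rewrite (_ : cylinder s B =
    \bigcap_(j in [set` s]) ((fun x : T => x j) @^-1` B j)).
  apply: fin_bigcap_measurable; first exact: finite_seq.
  by move=> j _; rewrite -[X in measurable X]setTI; exact: measurable_coord.
by apply/seteqP; split => x /= xB j /=; exact: xB.
Qed.

Lemma measurable_RJ_fun (f : T -> T) :
  (forall j, measurable_fun setT (fun x => f x j)) -> measurable_fun setT f.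
Proof.
move=> mf; apply: (@measurability _ _ T T setT f (@coord_preimages R D) erefl).
move=> _ [_ [j [B mB ->]] <-].
by have := mf j measurableT B mB.
Qed.

(** A pi-system generating the product sigma-algebra. Constraining only initial lists of coordinates
    puts the sets in the form matching the partial products. *)
Definition initial_cylinders : set (set T) :=
  [set A | exists n, exists2 B : indices D -> set R,
    (forall j, measurable (B j)) & A = cylinder (initial_indices D n) B].

Lemma initial_cylinders_setI : setI_closed initial_cylinders.
Proof.
move=> _ _ [n [B mB ->]] [m [C mC ->]].
pose BC j := (if j \in initial_indices D n then B j else setT) `&`
             (if j \in initial_indices D m then C j else setT).
exists (maxn n m); exists BC.
  by move=> j; apply: measurableI; case: ifPn.
have sub k l : (k <= l)%N -> {subset initial_indices D k <= initial_indices D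
  l}.
  by move=> kl j jk; have [r ->] := initial_indices_cat D _ _ kl;
    rewrite mem_cat jk.
apply/seteqP; split => x /=.
  move=> [xB xC] j _; split; case: ifPn => // jn; [exact: xB|exact: xC].
move=> xBC; split => j jn.
  by have [] := xBC j (sub _ _ (leq_maxl n m) j jn); rewrite jn.
by have [_] := xBC j (sub _ _ (leq_maxr n m) j jn); rewrite jn.
Qed.

Lemma measurable_RJE : @measurable _ T = <<s initial_cylinders >>.
Proof.
apply/seteqP; split.
  apply: smallest_sub; first exact: smallest_sigma_algebra.
  move=> _ [j [B mB ->]]; apply: sub_sigma_algebra.
  have [n _ jn] := initial_indices_sub D [:: j].
  exists n; exists (fun i => if i == j then B else setT).
    by move=> i; case: ifPn.
  apply/seteqP; split => x /=.
    by move=> xB i _; case: eqP => // ->.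
  by move=> /(_ j (jn n (leqnn n) j _)); rewrite eqxx; apply; rewrite mem_seq1.
apply: smallest_sub; first exact: sigma_algebra_measurable.
by move=> _ [n [B mB ->]]; exact: measurable_cylinder.
Qed.

Lemma measurable_partial_prod (phi : indices D -> R -> R) n :
  (forall j, measurable_fun setT (phi j)) ->
  measurable_fun setT (fun x : T => partial_prod R D (fun j => phi j (x j)) n).
Proof.
move=> mphi; apply: measurable_prod => j _.
by apply: measurableT_comp => //; exact: measurable_coord.
Qed.

Lemma measurable_prodJ (phi : indices D -> R -> R) :
  (forall j, measurable_fun setT (phi j)) -> (forall j t, 0 <= phi j t <= 1) ->
  measurable_fun setT (fun x : T => prodJ (fun j => phi j (x j))).
Proof.
move=> mphi phi01; apply: (@measurable_fun_cvg _ T R setT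
  (fun n x => partial_prod R D (fun j => phi j (x j)) n)).
  by move=> n; exact: measurable_partial_prod.
by move=> x _; apply: cvg_partial_prod.
Qed.

End sequence_space.

(** * Integrals of product functions *)

Section normal_product.
Context (R : realType) (D : index_kind) (mu : probability (RJ R D) R).
Hypothesis hmu : is_normal_product mu.
Local Notation T := (RJ R D).
Local Notation gauss := (std_normal R).

Section unit_interval_factors.
Variable phi : indices D -> R -> R.
Hypotheses (mphi : forall j, measurable_fun setT (phi j))
  (phi01 : forall j t, 0 <= phi j t <= 1).

Lemma integral_gauss_factor_fin_num j :
  (\int[gauss]_t (phi j t)%:E)%E \is a fin_num.
Proof.
have phi0 t : 0 <= phi j t by have /andP[] := phi01 j t.
rewrite ge0_fin_numE; last by apply: integral_ge0 => t _; rewrite lee_fin.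
apply: (@le_lt_trans _ _ (\int[gauss]_t (cst 1%E t))%E).
  apply: ge0_le_integral => //.
  - by move=> t _; rewrite lee_fin.
  - by apply/measurable_EFinP; exact: mphi.
  - by move=> t _; rewrite lee_fin; have /andP[] := phi01 j t.
by rewrite integral_cst// mul1e [X in (X < _)%E]probability_setT ltry.
Qed.

(* Induction on [s] replaces indicators by the factors [phi j], one coordinate
   at a time. *)
Lemma integral_cylinder_prod (s t : seq (indices D)) (B : indices D -> set R) :
  uniq (s ++ t) -> (forall j, measurable (B j)) ->
  (\int[mu]_(x in cylinder R D t B) (\prod_(j <- s) phi j (x j))%:E =
   \prod_(j <- s) \int[gauss]_u (phi j u)%:E * \prod_(j <- t) gauss (B j))%E.
Proof.
have phi0 j u : 0 <= phi j u by have /andP[] := phi01 j u.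
elim: s t B => [|j s IH] t B /=.
  move=> ut mB; rewrite big_nil mul1e -hmu//.
  under eq_integral do rewrite big_nil.
  by rewrite integral_cst ?mul1e//; exact: measurable_cylinder.
move=> /andP[]; rewrite mem_cat negb_or => /andP[js jt] ust mB.
have mcyl := measurable_cylinder R D t B mB.
have prod0 (x : T) : 0 <= \prod_(i <- s) phi i (x i) by apply: prodr_ge0.
have mprod : measurable_fun setT (fun x : T => \prod_(i <- s) phi i (x i)).
  apply: measurable_prod => i _.
  by apply: measurableT_comp => //; exact: measurable_coord.
pose w (x : T) := \prod_(i <- s) phi i (x i) * \1_(cylinder R D t B) x.
pose C := (\prod_(i <- s) \int[gauss]_u (phi i u)%:E *
           \prod_(i <- t) gauss (B i))%E.
have Cfin : C \is a fin_num.
  apply: fin_numM; apply: prode_fin_num => i _.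
    exact: integral_gauss_factor_fin_num.
  by apply: fin_num_measure; exact: mB.
have C0 : (0 <= C)%E.
  apply: mule_ge0; apply: prode_ge0 => i _//.
  by apply: integral_ge0 => u _; rewrite lee_fin.
(* The coordinate j maps the measure with density [w] to a multiple of the normal law: this is the
   induction hypothesis with j moved to the list of constrained coordinates, and the reason for
   stating the lemma over cylinders. *)
have wE (A : set R) : measurable A ->
    (\int[mu]_(x in (fun x : T => x j) @^-1` A) (w x)%:E = (fine C)%:E * gauss
      A)%E.
  move=> mA; pose BA i := if i == j then A else B i.
  have mBA i : measurable (BA i) by rewrite /BA; case: ifPn.
  have ujt : uniq (s ++ j :: t).
    by rewrite -cat1s uniq_catCA /= mem_cat negb_or js jt.
  have gaussB : (\prod_(i <- j :: t) gauss (BA i) =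
      gauss A * \prod_(i <- t) gauss (B i))%E.
    rewrite big_cons {1}/BA eqxx; congr (_ * _)%E; apply: eq_big_seq => i it.
    by rewrite /BA; case: eqP it jt => // -> ->.
  rewrite fineK// muleC /C muleCA -gaussB -(IH _ _ ujt mBA).
  have -> : cylinder R D (j :: t) BA = (fun x : T => x j) @^-1` A `&` cylinder
    R D t B.
    apply/seteqP; split => x /=.
      move=> xBA; split.
        by have := xBA j (mem_head _ _); rewrite /BA eqxx.
      move=> i it; have := xBA i _; rewrite /BA inE it orbT.
      by case: eqP it jt => [-> ->//|_ _ _]; apply.
    move=> [xA xB] i; rewrite inE /BA; case: eqP => [-> //|_ /=]; exact: xB.
  rewrite integral_mkcond [RHS]integral_mkcond; apply: eq_integral => x _.
  rewrite !patchE /w in_setI indicE.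
  by do 2 case: (x \in _); rewrite /= ?mulr1 ?mulr0.
rewrite !big_cons -muleA -/C muleC -[C]fineK//.
have w0 x : 0 <= w x by rewrite /w mulr_ge0.
have mw : measurable_fun setT w.
  by apply: measurable_funM => //; exact: measurable_indic.
rewrite -(ge0_integral_weighted_comp R _ _ T (measurableTypeR R) mu gauss w
  (fun x => x j) (fine C)
  w0 mw (measurable_coord R D j) wE)//.
- rewrite [LHS]integral_mkcond; apply: eq_integral => x _.
  rewrite patchE /w indicE big_cons -EFinM.
  by case: (x \in _); rewrite /= ?mulr1 ?mulr0 ?mul0r// mulrC.
- by apply/measurable_EFinP; exact: mphi.
- by move=> y; rewrite lee_fin.
Qed.

Lemma integral_prod (s : seq (indices D)) : uniq s ->
  (\int[mu]_x (\prod_(j <- s) phi j (x j))%:E =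
   \prod_(j <- s) \int[gauss]_u (phi j u)%:E)%E.
Proof.
move=> us; have := integral_cylinder_prod s [::] (fun=> setT).
rewrite cats0 big_nil mule1 => <-//.
by rewrite (_ : cylinder _ _ _ _ = setT)//; apply/seteqP; split.
Qed.

Lemma cvg_integral_partial_prod (A : set T) : measurable A ->
  (\int[mu]_(x in A) (partial_prod R D (fun j => phi j (x j)) n)%:E)%E
    @[n --> \oo] -->
  (\int[mu]_(x in A) (prodJ (fun j => phi j (x j)))%:E)%E.
Proof.
move=> mA; have [] // := @dominated_convergence _ T R mu A mA
  (fun n x => (partial_prod R D (fun j => phi j (x j)) n)%:E)
  (fun x => (prodJ (fun j => phi j (x j)))%:E) (cst 1%E).
- move=> n; apply: measurable_funTS; apply/measurable_EFinP.
  exact: measurable_partial_prod.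
- by apply: measurable_funTS; apply/measurable_EFinP; exact: measurable_prodJ.
- apply: aeW => x _; apply: cvg_EFin; first exact: nearW.
  by apply: cvg_partial_prod.
- apply/integrableP; split; first exact: measurable_cst.
  rewrite (eq_integral (cst 1%E)); last by move=> x _; rewrite /= normr1.
  rewrite integral_cst// mul1e; apply: (@le_lt_trans _ _ 1%E); last exact: ltry.
  exact: probability_le1.
- apply: aeW => x n _; rewrite /= lee_fin.
  by have /andP[p0 p1] := partial_prod_itv R D (fun j => phi j (x j)) n (fun j
    => phi01 j (x j));
    rewrite ger0_norm.
Qed.

Lemma integral_prodJ (q : indices D -> R) : (forall j, 0 <= q j <= 1) ->
  (forall j, \int[gauss]_u (phi j u)%:E = (q j)%:E)%E ->
  (\int[mu]_x (prodJ (fun j => phi j (x j)))%:E = (prodJ q)%:E)%E.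
Proof.
move=> q01 qE.
apply: (cvg_unique _ (cvg_integral_partial_prod setT measurableT)) => //.
rewrite (_ : (fun n => _) = (fun n => (partial_prod R D q n)%:E)).
  by apply: cvg_EFin; [exact: nearW|exact: cvg_partial_prod].
apply/funext => n; rewrite integral_prod ?initial_indices_uniq//.
by under eq_bigr do rewrite qE; rewrite prodEFin.
Qed.

End unit_interval_factors.
End normal_product.

(** * Rescaling the Gaussian product measure *)

Section gaussian_scaling.
Context (R : realType) (D : index_kind) (mu : probability (RJ R D) R).
Hypothesis hmu : is_normal_product mu.
Local Notation T := (RJ R D).
Local Notation gauss := (std_normal R).
Variable a : indices D -> R.
Hypothesis a_ge0 : forall j, 0 <= a j.

Definition scale_coords (s : indices D -> R) (x : T) : T := fun j => s j * x j.

Definition dilation (j : indices D) : R := Num.sqrt (1 + 2 * a j).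

Definition gauss_weight (x : T) : R := prodJ (fun j => expR (- (a j * x j ^+
  2))).

Lemma measurable_scale_coords s : measurable_fun setT (scale_coords s).
Proof.
apply: measurable_RJ_fun => j; apply: measurable_funM => //.
exact: measurable_coord.
Qed.

Lemma dilation_ge1 j : 1 <= dilation j.
Proof. by rewrite -[leLHS]sqrtr1 ler_wsqrtr// lerDl mulr_ge0. Qed.

Lemma dilationV_itv j : 0 <= (dilation j)^-1 <= 1.
Proof.
have d1 := dilation_ge1 j; have d0 := lt_le_trans ltr01 d1.
by rewrite invr_ge0 (ltW d0) invf_le1.
Qed.

Let phi01 j t : 0 <= expR (- (a j * t ^+ 2)) <= 1.
Proof. by rewrite expR_ge0 /= -expR0 ler_expR oppr_le0 mulr_ge0// sqr_ge0. Qed.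

Let mphi j : measurable_fun setT (fun t : R => expR (- (a j * t ^+ 2))).
Proof.
apply: measurableT_comp => //; apply: measurableT_comp => //.
by apply: measurable_funM => //; exact: measurable_funX.
Qed.

Lemma measurable_gauss_weight : measurable_fun setT gauss_weight.
Proof. exact: (measurable_prodJ R D _ mphi phi01). Qed.

Lemma gauss_weight_itv x : 0 <= gauss_weight x <= 1.
Proof. exact: prodJ_itv. Qed.

(** By the pi-lambda argument [A] may be an initial cylinder. There the integral of the m-th partial
    product of the weight factorises into one-dimensional rescalings, and m tends to infinity. *)
Lemma integral_gauss_weight_dilation (A : set T) : measurable A ->
  (\int[mu]_(x in scale_coords dilation @^-1` A) (gauss_weight x)%:E =
   (prodJ (fun j => (dilation j)^-1))%:E * mu A)%E.
Proof.
have mS := measurable_scale_coords dilation.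
have mpre E : measurable E -> measurable (scale_coords dilation @^-1` E).
  by move=> mE; rewrite -[X in measurable X]setTI; exact: mS.
apply: (integral_weighted_preimage_dynkin R _ _ T T mu mu gauss_weight
  (scale_coords dilation) (prodJ (fun j => (dilation j)^-1))
  _ measurable_gauss_weight mS (initial_cylinders R D)).
- by move=> x; have /andP[] := gauss_weight_itv x.
- exact: measurable_RJE.
- exact: initial_cylinders_setI.
- by exists 0%N, (fun=> setT) => //; apply/seteqP; split.
- by rewrite [X in (X < _)%E]probability_setT ltry.
move=> _ [n [B mB ->]].
apply: (cvg_unique _ (cvg_integral_partial_prod R D mu _ mphi phi01 _ (mpre _
  _))) => //.
  exact: measurable_cylinder.
have lim_q : ((partial_prod R D (fun j => (dilation j)^-1) m)%:E *
    mu (cylinder R D (initial_indices D n) B))%E @[m --> \oo] -->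
    ((prodJ (fun j => (dilation j)^-1))%:E * mu (cylinder R D (initial_indices
      D n) B))%E.
  apply: cvgeZr; first exact: fin_num_measure (measurable_cylinder _ _ _ _ mB).
  apply: cvg_EFin; first exact: nearW.
  by apply: cvg_partial_prod => j; exact: dilationV_itv.
apply: cvg_trans lim_q; apply: near_eq_cvg; near=> m.
have nm : {subset initial_indices D n <= initial_indices D m}.
  by near: m; exact: initial_indices_sub.
(* The cylinder is rewritten over the longer list of m coordinates, unconstrained in the new ones,
   so that the constraints and the partial product run over the same list. *)
pose B' j := if j \in initial_indices D n then B j else setT.
have mB' j : measurable (B' j) by rewrite /B'; case: ifPn.
have -> : cylinder R D (initial_indices D n) B = cylinder R D (initial_indices
  D m) B'.
  apply/seteqP; split => x /= xB j jm; rewrite ?/B'.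
    by case: ifPn => // jn; exact: xB.
  by have := xB j (nm j jm); rewrite /B' jm.
rewrite hmu ?initial_indices_uniq//.
(* The indicator of the preimage of the cylinder is itself a product over coordinates and is
   absorbed into the factors. *)
pose psi j t := expR (- (a j * t ^+ 2)) * \1_(B' j) (dilation j * t).
transitivity (\int[mu]_x (\prod_(j <- initial_indices D m) psi j (x j))%:E)%E;
  last first.
  apply/esym; rewrite [LHS]integral_mkcond; apply: eq_integral => x _.
  rewrite patchE /partial_prod.
  have -> : (x \in scale_coords dilation @^-1` cylinder R D (initial_indices D
    m) B') =
            all (fun j => dilation j * x j \in B' j) (initial_indices D m).
    apply/idP/allP => [/set_mem xB j jm|xB]; first exact/mem_set/xB.
    by apply/mem_set => j jm; exact/set_mem/xB.
  elim: (initial_indices D m) => [|j s IH] /=; first by rewrite !big_nil.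
  rewrite !big_cons {1}/psi indicE; case: (_ \in _) => /=;
    last by rewrite mulr0 mul0r.
  by rewrite mulr1 [RHS]EFinM -IH; case: ifPn => _; rewrite ?EFinM// mule0.
rewrite (@integral_prod R D mu hmu psi) ?initial_indices_uniq//.
- rewrite /partial_prod -prodEFin -big_split /=; apply: eq_bigr => j _.
  rewrite -integral_std_normal_preimage_scale// [LHS]integral_mkcond.
  apply: eq_integral => t _; rewrite patchE /psi indicE.
  rewrite (_ : (t \in _ @^-1` _) = (dilation j * t \in B' j)).
    by case: ifPn => /= _; rewrite ?mulr1 ?mulr0.
  by apply/idP/idP => /set_mem/mem_set.
- move=> j; apply: measurable_funM; first exact: mphi.
  apply: measurableT_comp; first exact: measurable_indic.
  by apply: measurable_funM.
- move=> j t; have /andP[e0 e1] := phi01 j t.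
  by rewrite /psi indicE; case: (_ \in _);
    rewrite ?mulr1 ?mulr0 ?e0 ?lexx ?ler01.
Unshelve. all: end_near. Qed.

End gaussian_scaling.

(** * Weighted square-summable sequences *)

Section ell2_full_measure.
Context (R : realType) (D : index_kind).
Local Notation T := (RJ R D).
Implicit Types (a b : indices D -> R).

Lemma sumJ_finite_le a b (c : R) : (forall j, 0 <= a j) -> (forall j, 0 <= b j)
  ->
  0 <= c -> (forall j, a j <= c * b j) -> sumJ_finite b -> sumJ_finite a.
Proof.
move=> a0 b0 c0 ab /(sumJ_finiteP R D b b0)[C bC].
apply/(sumJ_finiteP R D a a0); exists (c * C) => n.
apply: (@le_trans _ _ (c * \sum_(j <- initial_indices D n) b j)).
  by rewrite mulr_sumr ler_sum.
by rewrite ler_wpM2l.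
Qed.

Lemma ell2_le a b (c : R) : (forall j, 0 <= a j) -> (forall j, 0 <= b j) ->
  0 <= c -> (forall j, a j <= c * b j) -> ell2 b `<=` ell2 a.
Proof.
move=> a0 b0 c0 ab x; apply: (sumJ_finite_le _ _ c) => // j.
- by rewrite mulr_ge0// sqr_ge0.
- by rewrite mulr_ge0// sqr_ge0.
- by rewrite mulrA ler_wpM2r// sqr_ge0.
Qed.

(** The partial products of the weight are exp of minus the partial sums and decrease to it; a
    positive limit g thus bounds these sums by - ln g. Measurability of [ell2] follows. *)
Lemma gauss_weight_gt0 a : (forall j, 0 <= a j) ->
  ell2 a = [set x | 0 < gauss_weight R D a x].
Proof.
move=> a0; have ax0 (x : T) j : 0 <= a j * x j ^+ 2 by rewrite mulr_ge0//
  sqr_ge0.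
have e01 (x : T) j : 0 <= expR (- (a j * x j ^+ 2)) <= 1.
  by rewrite expR_ge0 /= -expR0 ler_expR oppr_le0.
apply/seteqP; split => x /=.
  move=> xa; apply: (prodJ_gt0 R D _ (fun j => a j * x j ^+ 2)) => // j.
  by rewrite lexx; have /andP[] := e01 x j.
move=> g0; apply/(sumJ_finiteP R D _ (ax0 x)).
exists (- ln (gauss_weight R D a x)) => n.
rewrite lerNr -ler_expR lnK ?posrE//.
have cvg_g := cvg_partial_prod R D _ (e01 x).
rewrite /gauss_weight -(cvg_lim _ cvg_g)// -sumrN expR_sum.
by apply: nonincreasing_cvgn_ge;
  [exact: partial_prod_nonincreasing|exact: cvgP cvg_g].
Qed.

Lemma measurable_ell2 a : (forall j, 0 <= a j) -> measurable (ell2 a : set T).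
Proof.
move=> a0; rewrite gauss_weight_gt0//.
rewrite (_ : [set x | _] = gauss_weight R D a @^-1` `]0, +oo[%classic).
  rewrite -[X in measurable X]setTI.
  by apply: measurable_gauss_weight => //; exact: measurable_itv.
by apply/seteqP; split => x /=; rewrite in_itv/= andbT.
Qed.

(* The functions exp (- sum_j a_j x_j ^ 2 / (k + 1)) vanish outside [ell2 a],
  and
   their integrals tend to 1 as k tends to infinity. *)
Lemma probability_ell2 (mu : probability T R) a : is_normal_product mu ->
  (forall j, 0 <= a j) -> sumJ_finite a -> mu (ell2 a) = 1%E.
Proof.
move=> hmu a0 fin_a.
have mX := measurable_ell2 _ a0.
apply/eqP; rewrite eq_le probability_le1//=.
have [C aC] := (sumJ_finiteP R D a a0).1 fin_a.
pose d (k : nat) j : R := (dilation R D (fun j => k.+1%:R^-1 * a j) j)^-1.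
have ka0 (k : nat) j : 0 <= k.+1%:R^-1 * a j by rewrite mulr_ge0.
(* With u_j = a_j / (k + 1), the integral over the whole space is the product of (1 + 2 u_j)^(-1/2),
   which 1 + 2 u <= exp (2 u) bounds below by exp (- sum_j u_j). *)
have lower k : ((expR (- (k.+1%:R^-1 * C)))%:E <= mu (ell2 a))%E.
  have := integral_gauss_weight_dilation R D mu hmu _ (ka0 k) setT measurableT.
  rewrite preimage_setT [X in (_ * X)%E]probability_setT mule1 => intE.
  apply: (@le_trans _ _ (prodJ (d k))%:E).
    rewrite lee_fin; have cvg_d := cvg_partial_prod R D _ (dilationV_itv R D _
      (ka0 k)).
    rewrite -(cvg_lim _ cvg_d)//; apply: limr_ge; first exact: cvgP cvg_d.
    apply: nearW => n; rewrite /partial_prod.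
    apply: (@le_trans _ _ (expR (- \sum_(j <- initial_indices D n) k.+1%:R^-1 *
      a j))).
      by rewrite ler_expR lerN2 -mulr_sumr ler_wpM2l.
    rewrite -sumrN expR_sum; apply: ler_prod => j _; rewrite expR_ge0 /=.
    set u := _ * a j; rewrite expRN lef_pV2 ?posrE ?expR_gt0//; last first.
      by rewrite (lt_le_trans ltr01)// dilation_ge1.
    rewrite -ler_sqr ?nnegrE ?expR_ge0 ?sqrtr_ge0//.
    rewrite sqr_sqrtr ?addr_ge0 ?mulr_ge0// -expRM_natl.
    exact: expR_ge1Dx.
  rewrite -[mu _]mul1e -(integral_cst mu mX) -intE [leRHS]integral_mkcond.
  apply: ge0_le_integral => //.
  - by move=> x _; rewrite lee_fin;
    have /andP[] := gauss_weight_itv R D _ (ka0 k) x.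
  - by apply/measurable_EFinP; exact: measurable_gauss_weight.
  - by apply/(measurable_restrictT _ _).1 => //; exact: measurable_cst.
  move=> x _; rewrite patchE; case: ifPn => xX.
    by rewrite lee_fin; have /andP[] := gauss_weight_itv R D _ (ka0 k) x.
  rewrite lee_fin leNgt; apply: contra xX => g0; apply/mem_set.
  apply: (ell2_le _ (fun j => k.+1%:R^-1 * a j) k.+1%:R) => //.
    by move=> j; rewrite mulrA mulfV ?mul1r// pnatr_eq0.
  by rewrite gauss_weight_gt0.
have lim1 : (expR (- (k.+1%:R^-1 * C)))%:E @[k --> \oo] --> 1%E.
  apply: cvg_EFin; first exact: nearW.
  rewrite -[X in _ --> X]expR0; apply: continuous_cvg;
    first exact: continuous_expR.
  rewrite -oppr0; apply: cvgN; rewrite -(mul0r C); apply: cvgMl;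
    exact: cvg_harmonic.
rewrite -(cvg_lim _ lim1)//; apply: lime_le; first exact: cvgP lim1.
by apply: nearW => k; exact: lower.
Qed.

End ell2_full_measure.

(** * Reproducing kernel Hilbert spaces *)

Section inner_product.
Context (R : realType) (E : completeNormedModType R) (ip : E -> E -> R).
Hypotheses (ip_sym : forall f g, ip f g = ip g f)
  (ip_linear : forall a f g h, ip (a *: f + g) h = a * ip f h + ip g h)
  (ip_norm : forall f, ip f f = `|f| ^+ 2).

Lemma ip0l h : ip 0 h = 0.
Proof. by have := ip_linear (- 1) 0 0 h; rewrite scaler0 addr0; lra. Qed.

Lemma ipDl f g h : ip (f + g) h = ip f h + ip g h.
Proof. by rewrite -[f]scale1r ip_linear mul1r scale1r. Qed.

Lemma ipZl a f h : ip (a *: f) h = a * ip f h.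
Proof. by rewrite -[a *: f]addr0 ip_linear ip0l addr0. Qed.

Lemma ipBl f g h : ip (f - g) h = ip f h - ip g h.
Proof. by rewrite -scaleN1r ipDl ipZl mulN1r. Qed.

Lemma ipDr f g h : ip h (f + g) = ip h f + ip h g.
Proof. by rewrite ip_sym ipDl ![ip _ h]ip_sym. Qed.

Lemma ipZr a f h : ip h (a *: f) = a * ip h f.
Proof. by rewrite ip_sym ipZl [ip f h]ip_sym. Qed.

Lemma sqr_normD f g : `|f + g| ^+ 2 = `|f| ^+ 2 + 2 * ip f g + `|g| ^+ 2.
Proof. by rewrite -!ip_norm ipDl !ipDr [ip g f]ip_sym; ring. Qed.

Lemma sqr_normDZ (t : R) f g :
  `|f + t *: g| ^+ 2 = `|f| ^+ 2 + 2 * t * ip f g + t ^+ 2 * `|g| ^+ 2.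
Proof. by rewrite sqr_normD ipZr normrZ exprMn real_normK ?num_real// mulrA.
  Qed.

Lemma parallelogram (f g : E) :
  `|f - g| ^+ 2 = 2 * `|f| ^+ 2 + 2 * `|g| ^+ 2 - 4 * `|2^-1 *: (f + g)| ^+ 2.
Proof.
rewrite normrZ exprMn real_normK ?num_real// -scaleN1r sqr_normDZ sqr_normD.
by field.
Qed.

Lemma cauchy_schwarz f g : `|ip f g| <= `|f| * `|g|.
Proof.
have [/eqP|g0] := eqVneq (`|g|) 0.
  by rewrite normr_eq0 => /eqP ->; rewrite ip_sym ip0l normr0 normr0 mulr0.
rewrite -ler_sqr ?nnegrE ?mulr_ge0// real_normK ?num_real// exprMn.
have := sqr_ge0 (`|f + (- ip f g / `|g| ^+ 2) *: g|).
rewrite sqr_normDZ (_ : _ + _ = `|f| ^+ 2 - ip f g ^+ 2 / `|g| ^+ 2).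
  by rewrite subr_ge0 ler_pdivrMr// exprn_gt0// lt_def g0 normr_ge0.
by field.
Qed.

Definition seq_closed (C : set E) := forall (u : nat -> E) (f : E),
  (forall n, C (u n)) -> u n @[n --> \oo] --> f -> C f.

Lemma min_norm (C : set E) : C !=set0 -> seq_closed C ->
  (forall f g, C f -> C g -> C (2^-1 *: (f + g))) ->
  exists2 k, C k & forall f, C f -> `|k| <= `|f|.
Proof.
move=> [f0 Cf0] closedC midC.
pose N : set R := [set `|f| | f in C].
have infN : has_inf N.
  by split; [exists `|f0|, f0|exists 0 => _ [f _ <-]].
pose d := inf N.
have dC f : C f -> d <= `|f| by move=> Cf; apply: ge_inf;
  [exact: infN.2|exists f].
have d0 : 0 <= d by apply: lb_le_inf => [|_ [f _ <-]//]; exact: infN.1.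
have /choice[u uP] : forall n, exists f, C f /\ `|f| < d + n.+1%:R^-1.
  move=> n; have [_ [f Cf <-] fd] := @inf_adherent _ N n.+1%:R^-1 (ltac:(by
    rewrite invr_gt0)) infN.
  by exists f.
have uC n : C (u n) by have [] := uP n.
have u_lt n : `|u n| < d + n.+1%:R^-1 by have [] := uP n.
(* With e = 1 / (n + 1), the parallelogram identity leaves 4 ((d + e)^2 - d^2) = 8 d e + 4 e^2, and
   e <= 1. *)
have dist n m : (n <= m)%N -> `|u n - u m| ^+ 2 <= 8 * (d + 1) * n.+1%:R^-1.
  move=> nm; rewrite parallelogram.
  have h0 := dC _ (midC _ _ (uC n) (uC m)).
  set e := n.+1%:R^-1.
  have e0 : 0 < e by rewrite invr_gt0.
  have e1 : e <= 1 by rewrite invf_le1// ler1n.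
  have hn : `|u n| < d + e := u_lt n.
  have hm : `|u m| < d + e.
    by apply: lt_le_trans (u_lt m) _; rewrite lerD2l lef_pV2 ?posrE// ler_nat.
  have q0 : d ^+ 2 <= `|2^-1 *: (u n + u m)| ^+ 2 by rewrite ler_sqr ?nnegrE.
  have qn : `|u n| ^+ 2 <= (d + e) ^+ 2 by rewrite ler_sqr ?nnegrE ?addr_ge0//
    ltW.
  have qm : `|u m| ^+ 2 <= (d + e) ^+ 2 by rewrite ler_sqr ?nnegrE ?addr_ge0//
    ltW.
  nra.
have cvg_u : cvg (u n @[n --> \oo]).
  apply: cauchy_cvg; apply: cauchy_exP => e e0.
  have [M _ MP] : \forall n \near \oo, (8 * (d + 1) * n.+1%:R^-1 : R) < e ^+ 2.
    have : 8 * (d + 1) * n.+1%:R^-1 @[n --> \oo] --> (0 : R).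
      by rewrite -(mulr0 (8 * (d + 1))); apply: cvgMr; exact: cvg_harmonic.
    by move=> /cvgr_lt /(_ _ (exprn_gt0 2 e0)).
  exists (u M); exists M => // n /= Mn; rewrite -ball_normE /=.
  by rewrite -ltr_sqr ?nnegrE ?(ltW e0)//; apply: le_lt_trans (dist _ _ Mn) _;
    exact: (MP M (leqnn M)).
have /cvg_ex[k uk] := cvg_u.
have Ck : C k by exact: closedC uC uk.
exists k => // f Cf; apply: le_trans (dC f Cf).
have nk : `|u n| @[n --> \oo] --> `|k| by exact: cvg_norm uk.
have dk : d + n.+1%:R^-1 @[n --> \oo] --> d.
  by rewrite -[X in _ --> X]addr0; apply: cvgD;
    [exact: cvg_cst|exact: cvg_harmonic].
by apply: ler_cvg_to nk dk _; apply: nearW => n; exact: ltW.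
Qed.

Lemma min_norm_orthogonal k g : (forall t : R, `|k| <= `|k + t *: g|) -> ip k g
  = 0.
Proof.
move=> kmin; set p := ip k g; set q := `|g| ^+ 2.
have q0 : 0 <= q by exact: sqr_ge0.
have q1 : 0 < q + 1 by lra.
(* The quadratic in t is smallest at - p / q; the denominator q + 1 also covers g = 0 and still
   gives a decrease unless p = 0. *)
have := kmin (- p / (q + 1)).
rewrite -ler_sqr ?nnegrE// sqr_normDZ -/p -/q -addrA lerDl => h.
apply/eqP; rewrite -sqrf_eq0 eq_le sqr_ge0 andbT.
suff : 0 <= - (p ^+ 2 * (q + 2)) by nra.
rewrite (_ : - _ = (2 * (- p / (q + 1)) * p + (- p / (q + 1)) ^+ 2 * q) * (q +
  1) ^+ 2).
  by rewrite mulr_ge0// sqr_ge0.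
by field; rewrite gt_eqF.
Qed.

(** The element [k] of minimal norm in the closed hyperplane I = 1 is orthogonal to the kernel of
    [I]. As f - (I f) k lies in that kernel, I f = <f, k> / |k|^2. *)
Lemma riesz_representation (I : E -> R) (M : R) :
  (forall a f g, I (a *: f + g) = a * I f + I g) -> (forall f, `|I f| <= M *
    `|f|) ->
  exists k, forall f, I f = ip f k.
Proof.
move=> I_linear I_bounded.
have I0 : I 0 = 0 by have := I_linear (- 1) 0 0; rewrite scaler0 addr0; lra.
have IZ a f : I (a *: f) = a * I f by rewrite -[a *: f]addr0 I_linear I0 addr0.
have ID f g : I (f + g) = I f + I g by rewrite -[f]scale1r I_linear mul1r
  scale1r.
have [Izero|/existsNP[f0 /eqP If0]] := pselect (forall f, I f = 0).
  by exists 0 => f; rewrite ip_sym ip0l.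
have closedC : seq_closed [set f | I f = 1].
  move=> u f Iu uf /=; apply/eqP;
    rewrite -subr_eq0 -normr_eq0 eq_le normr_ge0 andbT.
  have bnd n : `|I f - 1| <= M * `|f - u n|.
    by rewrite -(Iu n) -mulN1r -IZ -ID scaleN1r.
  have lim0 : M * `|f - u n| @[n --> \oo] --> 0.
    rewrite -(mulr0 M); apply: cvgMr; rewrite -(normr0 E) -(subrr f).
    by apply: cvg_norm; apply: cvgB; [exact: cvg_cst|].
  rewrite -(cvg_lim _ lim0)//; apply: limr_ge; first exact: cvgP lim0.
  exact: nearW.
have [||k Ik kmin] := min_norm [set f | I f = 1] _ closedC.
- by exists ((I f0)^-1 *: f0); rewrite /= IZ mulVf.
- by move=> f g /= If Ig; rewrite IZ ID If Ig; field.
have kI g : I g = 0 -> ip k g = 0.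
  move=> Ig; apply: min_norm_orthogonal => t; apply: kmin.
  by rewrite /= ID IZ Ig mulr0 addr0.
have k0 : `|k| ^+ 2 != 0.
  rewrite sqrf_eq0 normr_eq0; apply/eqP => k0.
  by move: Ik; rewrite /= k0 I0 => /eqP; rewrite eq_sym oner_eq0.
exists ((`|k| ^+ 2)^-1 *: k) => f; rewrite ipZr.
have : ip k (f - I f *: k) = 0.
  by apply: kI; rewrite -scaleN1r ID !IZ Ik; ring.
rewrite -scaleN1r ipDr !ipZr ip_norm mulN1r => /eqP; rewrite subr_eq0 => /eqP.
by move=> kf; rewrite [ip f k]ip_sym kf mulrC mulfK.
Qed.

(** The element of minimal norm in the coset F + V is orthogonal to [V], hence 0; so 0 lies in the
    coset and F in [V]. *)
Lemma total_orthogonal (V : set E) : V 0 ->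
  (forall a f g, V f -> V g -> V (a *: f + g)) -> seq_closed V ->
  (forall k, (forall f, V f -> ip f k = 0) -> k = 0) -> forall f, V f.
Proof.
move=> V0 V_linear closedV Vorth F.
have VZ a f : V f -> V (a *: f) by move=> Vf; rewrite -[_ *: _]addr0;
  exact: V_linear.
have VD f g : V f -> V g -> V (f + g) by rewrite -{2}[f]scale1r;
  exact: V_linear.
have closedC : seq_closed [set f | V (f - F)].
  move=> u f Vu uf /=; apply: (closedV (fun n => u n - F)) => //.
  by apply: cvgB => //; exact: cvg_cst.
have [||k Vk kmin] := min_norm [set f | V (f - F)] _ closedC.
- by exists F; rewrite /= subrr.
- move=> f g /= Vf Vg; rewrite (_ : _ - F = 2^-1 *: ((f - F) + (g - F))).
    by apply: VZ; exact: VD.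
  rewrite [in RHS]addrACA -opprD [in RHS]scalerBr -[F + F]mulr2n -[F *+
    2]scaler_nat scalerA.
  by rewrite mulVf// scale1r.
have k0 : k = 0.
  apply: Vorth => f Vf; rewrite ip_sym; apply: min_norm_orthogonal => t.
  by apply: kmin; rewrite /= addrAC; apply: VD => //; exact: VZ.
by move: Vk; rewrite /= k0 sub0r => /(VZ (- 1)); rewrite scaleN1r opprK.
Qed.

End inner_product.

(** * Consequences of the reproducing property *)

Section rkhs.
Context (R : realType) (T : Type) (X : set T) (M : T -> T -> R) (H : RKHS X M).
Implicit Types (f g : H).

Let ip := @rkhs_inner R T X M H.

Lemma rkhs_eval0 x : X x -> rkhs_eval (0 : H) x = 0.
Proof.
move=> Xx; have := rkhs_eval_linear (- 1) (0 : H) 0 Xx.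
by rewrite scaler0 addr0; lra.
Qed.

Lemma rkhs_evalB f g x : X x -> rkhs_eval (f - g) x = rkhs_eval f x - rkhs_eval
  g x.
Proof.
by move=> Xx; rewrite -scaleN1r addrC rkhs_eval_linear// mulN1r addrC.
Qed.

Lemma rkhs_eval_bound y : X y -> forall f, `|rkhs_eval f y| <= `|f| * Num.sqrt
  (M y y).
Proof.
move=> Xy; have [k kE kf] := rkhs_reproducing H Xy.
have kk : `|k| = Num.sqrt (M y y).
  by rewrite -(kE y Xy) -kf rkhs_inner_norm sqrtr_sqr ger0_norm.
move=> f; rewrite -kf -kk.
exact: (cauchy_schwarz R H ip (@rkhs_inner_sym _ _ _ _ H)
  (@rkhs_inner_linear _ _ _ _ H) (@rkhs_inner_norm _ _ _ _ H)).
Qed.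

Lemma cvg_rkhs_eval (u : nat -> H) f y : X y ->
  u n @[n --> \oo] --> f -> rkhs_eval (u n) y @[n --> \oo] --> rkhs_eval f y.
Proof.
move=> Xy uf; apply/cvgrPdist_le => e e0.
pose s : R := Num.sqrt (M y y) + 1.
have s0 : 0 < s by rewrite ltr_wpDl// sqrtr_ge0.
move: uf => /cvgrPdist_le /(_ (e / s) (divr_gt0 e0 s0)) uf; near=> n.
rewrite -rkhs_evalB//; apply: le_trans (rkhs_eval_bound _ Xy _) _.
apply: (@le_trans _ _ (e / s * s)); last by rewrite divfK ?gt_eqF.
apply: ler_pM; rewrite ?sqrtr_ge0 ?normr_ge0 ?/s ?lerDl//.
by near: n; exact: uf.
Unshelve. all: end_near. Qed.

(** An element orthogonal to every kernel section vanishes at every point. Hence a property stable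
    under linear combinations and limits need only be checked on kernel sections. *)
Lemma rkhs_total (V : set H) : V 0 ->
  (forall a f g, V f -> V g -> V (a *: f + g)) -> seq_closed R H V ->
  (forall y k, X y -> (forall x, X x -> rkhs_eval k x = M x y) ->
     (forall f, rkhs_inner f k = rkhs_eval f y) -> V k) ->
  forall f, V f.
Proof.
move=> V0 V_linear closedV Vk.
apply: (total_orthogonal R H ip (@rkhs_inner_sym _ _ _ _ H)
  (@rkhs_inner_linear _ _ _ _ H) (@rkhs_inner_norm _ _ _ _ H)) => // k kV.
apply: rkhs_eval_inj => y Xy; rewrite rkhs_eval0//.
have [ky kyE kyf] := rkhs_reproducing H Xy.
by rewrite -kyf rkhs_inner_sym; apply: kV; exact: Vk Xy kyE kyf.
Qed.

End rkhs.

(** Norm convergence implies pointwise convergence on [X], so measurability passes to limits, and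
    the kernel sections determine it. *)
Lemma rkhs_measurable (R : realType) d (T : measurableType d) (X : set T)
    (M : T -> T -> R) (H : RKHS X M) : measurable X ->
  (forall y, X y -> measurable_fun X (M ^~ y)) ->
  forall f : H, measurable_fun X (rkhs_eval f).
Proof.
move=> mX mM; apply: (rkhs_total R T X M H [set f | measurable_fun X (rkhs_eval
  f)]) => /=.
- by apply: (eq_measurable_fun (cst (0 : R))) => // x /set_mem Xx;
  rewrite rkhs_eval0.
- move=> a f g mf mg.
  apply: (eq_measurable_fun (fun x => a * rkhs_eval f x + rkhs_eval g x)).
    by move=> x /set_mem Xx; rewrite rkhs_eval_linear.
  by apply: measurable_funD => //; exact: measurable_funM.
- move=> u f mu_ uf; apply: (measurable_fun_cvg mu_) => x Xx.
  exact: cvg_rkhs_eval.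
- move=> y k Xy kE _; apply: (eq_measurable_fun (M ^~ y)); last exact: mM.
  by move=> x /set_mem Xx; rewrite kE.
Qed.

(** * Weighted composition between reproducing kernel spaces *)

Section rkhs_weighted_composition.
Context (R : realType) (T1 T2 : Type) (X1 : set T1) (X2 : set T2).
Context (M1 : T1 -> T1 -> R) (M2 : T2 -> T2 -> R) (H1 : RKHS X1 M1) (H2 : RKHS
  X2 M2).
Variables (w : T1 -> R) (S : T1 -> T2).
Hypotheses (w0 : forall x, X1 x -> w x != 0) (SX : forall x, X1 x -> X2 (S x))
  (S_onto : forall y, X2 y -> exists2 x, X1 x & S x = y)
  (M12 : forall x y, X1 x -> X1 y -> M1 x y = w x * w y * M2 (S x) (S y)).

Let G (f : H1) (F : H2) :=
  forall x, X1 x -> rkhs_eval f x = w x * rkhs_eval F (S x).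

Let G_linear a f F g G' : G f F -> G g G' -> G (a *: f + g) (a *: F + G').
Proof.
move=> fF gG x Xx; have XS := SX x Xx.
by rewrite !rkhs_eval_linear// fF// gG// mulrDr mulrCA.
Qed.

(* The second conjunct, unlike equality of the norms, is linear in [(f, F)]. *)
Let P (f : H1) (F : H2) := G f F /\
  forall h K, G h K -> rkhs_inner f h = rkhs_inner F K.

Let P_linear a f F g G' : P f F -> P g G' -> P (a *: f + g) (a *: F + G').
Proof.
move=> [fF fE] [gG gE]; split; first exact: G_linear.
by move=> h K hK; rewrite !rkhs_inner_linear (fE _ _ hK) (gE _ _ hK).
Qed.

Let P_norm f F : P f F -> `|f| = `|F|.
Proof.
move=> [fF fE]; apply/eqP; rewrite -(@eqrXn2 _ 2)//.
by rewrite -!rkhs_inner_norm (fE _ _ fF).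
Qed.

Let P0 : P 0 0.
Proof.
split; first by move=> x Xx; rewrite !rkhs_eval0 ?mulr0//; exact: SX.
move=> h K _.
have := rkhs_inner_linear (- 1) (0 : H1) 0 h.
have := rkhs_inner_linear (- 1) (0 : H2) 0 K.
by rewrite !scaler0 !addr0; lra.
Qed.

(** The correspondence preserves norms of differences, so the partners [v] are Cauchy; continuity of
    evaluation and of the inner product carries [P] to the limits. *)
Let P_closed (u : nat -> H2) (v : nat -> H1) F : (forall n, P (v n) (u n)) ->
  u n @[n --> \oo] --> F -> exists f, P f F.
Proof.
move=> vu uF.
have dist n m : `|v n - v m| = `|u n - u m|.
  have := P_norm _ _ (P_linear (- 1) _ _ _ _ (vu m) (vu n)).
  by rewrite !scaleN1r ![- _ + _]addrC.
have cvg_v : cvg (v n @[n --> \oo]).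
  apply: cauchy_cvg; apply: cauchy_exP => e e0.
  have e2 : 0 < e / 2 by rewrite divr_gt0.
  move: uF => /cvgrPdist_lt /(_ _ e2) [N _ NP].
  exists (v N); exists N => // n /= Nn; rewrite -ball_normE /= dist.
  rewrite -(subrKA F) (splitr e); apply: le_lt_trans (ler_normD _ _) _.
  by apply: ltrD; [rewrite distrC; exact: (NP N (leqnn N))|exact: (NP n Nn)].
have /cvg_ex[f vf] := cvg_v.
exists f; split.
  move=> x Xx; apply: (cvg_unique (@norm_hausdorff _ R) (cvg_rkhs_eval _ _ _ _
    H1 _ _ _ Xx vf)).
  rewrite (_ : (fun n => _) = (fun n => w x * rkhs_eval (u n) (S x)));
    last first.
    by apply/funext => n; exact: (vu n).1.
  by apply: cvgMr; apply: cvg_rkhs_eval => //; exact: SX.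
move=> h K hK.
have inner_cvg (HH : completeNormedModType R) (ip : HH -> HH -> R)
    (ip_sym : forall f g, ip f g = ip g f)
    (ip_lin : forall a f g h, ip (a *: f + g) h = a * ip f h + ip g h)
    (ip_nrm : forall f, ip f f = `|f| ^+ 2) (z : nat -> HH) (g k : HH) :
    z n @[n --> \oo] --> g -> ip (z n) k @[n --> \oo] --> ip g k.
  move=> zg; apply/cvgrPdist_le => e e0.
  have k0 : 0 < `|k| + 1 by rewrite ltr_wpDl.
  move: zg => /cvgrPdist_le /(_ (e / (`|k| + 1)) (divr_gt0 e0 k0)) zg; near=> n.
  rewrite -(ipBl R HH ip ip_lin);
    apply: le_trans (cauchy_schwarz R HH ip ip_sym ip_lin ip_nrm _ _) _.
  apply: (@le_trans _ _ (e / (`|k| + 1) * (`|k| + 1)));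
    last by rewrite divfK ?gt_eqF.
  by apply: ler_pM => //; [near: n; exact: zg|rewrite lerDl].
have c1 := inner_cvg H1 _ (@rkhs_inner_sym _ _ _ _ H1) (@rkhs_inner_linear _ _
  _ _ H1)
  (@rkhs_inner_norm _ _ _ _ H1) v f h vf.
have c2 := inner_cvg H2 _ (@rkhs_inner_sym _ _ _ _ H2) (@rkhs_inner_linear _ _
  _ _ H2)
  (@rkhs_inner_norm _ _ _ _ H2) u F K uF.
apply: (cvg_unique (@norm_hausdorff _ R) c1).
by rewrite (_ : (fun n => _) = (fun n => rkhs_inner (u n) K))//;
  apply/funext => n;
  exact: (vu n).2.
Unshelve. all: end_near. Qed.

Lemma rkhs_weighted_comp (F : H2) : exists2 f : H1,
  (forall x, X1 x -> rkhs_eval f x = w x * rkhs_eval F (S x)) & `|f| = `|F|.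
Proof.
suff : forall F, exists f, P f F.
  by move=> /(_ F)[f fF]; exists f; [exact: fF.1|exact: P_norm].
apply: rkhs_total.
- by exists 0; exact: P0.
- by move=> a f g [f' Pf] [g' Pg]; exists (a *: f' + g'); exact: P_linear.
- move=> u F' /choice[v vP] uF; exact: P_closed vP uF.
- move=> y K Xy KE Kf; have [x Xx xy] := S_onto y Xy.
  have [k kE kf] := rkhs_reproducing H1 Xx.
  have wx := w0 x Xx.
  have ZE (h : H1) z : X1 z -> rkhs_eval ((w x)^-1 *: h) z = (w x)^-1 *
    rkhs_eval h z.
    by move=> Xz; rewrite -[_ *: h]addr0 rkhs_eval_linear// rkhs_eval0// addr0.
  (* The partner of the kernel section at y = S x is the section at x divided by w x: its inner
     product with h is h x / w x, the value at y of the partner of h. *)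
  exists ((w x)^-1 *: k); split.
    move=> z Xz; rewrite ZE// kE// M12// xy (KE _ (SX _ Xz)).
    by rewrite [w z * w x]mulrC -!mulrA mulKf.
  move=> h K' hK'; rewrite [RHS]rkhs_inner_sym Kf -xy.
  rewrite (ipZl R H1 _ (@rkhs_inner_linear _ _ _ _ H1)) rkhs_inner_sym kf hK'//.
  by rewrite mulKf.
Qed.

End rkhs_weighted_composition.

(** * The Gaussian and the Hermite kernel *)

Section gauss_hermite_kernels.
Context (R : realType) (D : index_kind).
Local Notation T := (RJ R D).
Variables sigma beta : indices D -> R.
Hypotheses (sigma_gt0 : forall j, 0 < sigma j)
  (sigma_sum : sumJ_finite (fun j => sigma j ^+ 2))
  (hbeta : forall j, 1 - beta j = 1 / (1 + 2 * sigma j ^+ 2)).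

(* [kernel_scale], [kernel_constant], [kernel_weight] are s_j, c, sqrt c * g. *)
Definition kernel_scale (j : indices D) : R := dilation R D (fun j => beta j /
  2) j.

Definition kernel_constant : R := prodJ (fun j => Num.sqrt (1 - beta j ^+ 2)).

Definition kernel_weight (x : T) : R :=
  Num.sqrt kernel_constant * gauss_weight R D (fun j => beta j / 2) x.

Lemma beta_itv j : 0 < beta j < 1.
Proof.
have s2 : 0 < 2 * sigma j ^+ 2 by rewrite mulr_gt0// exprn_gt0.
have b0 : 0 < 1 - beta j by rewrite hbeta divr_gt0// addr_gt0.
have b1 : 1 - beta j < 1 by rewrite hbeta ltr_pdivrMr ?addr_gt0// mul1r ltrDl.
by apply/andP; split; lra.
Qed.

Let beta_ge0 j : 0 <= beta j. Proof. by have /andP[/ltW] := beta_itv j. Qed.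

Let half_beta_ge0 j : 0 <= beta j / 2. Proof. by rewrite divr_ge0. Qed.

Lemma sigma_beta j : 2 * sigma j ^+ 2 * (1 - beta j) = beta j.
Proof.
have s2 : 0 < 2 * sigma j ^+ 2 by rewrite mulr_gt0// exprn_gt0.
have : (1 - beta j) * (1 + 2 * sigma j ^+ 2) = 1.
  by rewrite hbeta divfK// gt_eqF// addr_gt0.
lra.
Qed.

Lemma beta_le j : beta j <= 2 * sigma j ^+ 2.
Proof.
have /andP[b0 b1] := beta_itv j; have s0 := sqr_ge0 (sigma j).
by rewrite -{1}sigma_beta; nra.
Qed.

Lemma beta_sum : sumJ_finite beta.
Proof.
apply: (sumJ_finite_le R D _ _ 2 beta_ge0 _ _ beta_le sigma_sum) => //.
by move=> j; exact: sqr_ge0.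
Qed.

(** The two weights are comparable: beta_j <= 2 sigma_j^2 = beta_j (1 + 2 sigma_j^2) - beta_j +
    beta_j (1 - 1) + beta_j, and the bound C on all sigma_j^2 controls the factor 1 + 2
    sigma_j^2. *)
Lemma ell2_sigma_beta : ell2 (fun j => sigma j ^+ 2) = ell2 beta :> set T.
Proof.
have s0 j : 0 <= sigma j ^+ 2 by exact: sqr_ge0.
have [C sC] := (sumJ_finiteP R D _ s0).1 sigma_sum.
have sigma_C j : sigma j ^+ 2 <= C.
  have [n _ jn] := initial_indices_sub D [:: j].
  apply: le_trans (sC n); rewrite (bigD1_seq j) ?initial_indices_uniq//=.
    by rewrite lerDl sumr_ge0.
  by apply: (jn n (leqnn n)); rewrite mem_seq1.
have C0 : 0 <= C.
  by have := sC 0%N; apply: le_trans; apply: sumr_ge0.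
apply/seteqP; split.
  by apply: (ell2_le R D _ _ 2) => //; exact: beta_le.
apply: (ell2_le R D _ _ ((1 + 2 * C) / 2)) => //.
  by rewrite divr_ge0// addr_ge0// mulr_ge0.
move=> j; have := sigma_beta j; have := sigma_C j; have := s0 j.
have /andP[b0 b1] := beta_itv j.
have : (1 - beta j) * (1 + 2 * sigma j ^+ 2) = 1.
  by rewrite hbeta divfK// gt_eqF// addr_gt0// mulr_gt0// exprn_gt0.
by set u := sigma j ^+ 2; set b := beta j in b0 b1 *; nra.
Qed.

Lemma ell2_half_beta : ell2 (fun j => beta j / 2) = ell2 beta :> set T.
Proof.
apply/seteqP; split.
  by apply: (ell2_le R D _ _ 2) => // j; rewrite mulrC divfK.
by apply: (ell2_le R D _ _ 2^-1) => // j; rewrite mulrC.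
Qed.

Lemma kernel_scale_itv j : 1 <= kernel_scale j <= 2.
Proof.
rewrite dilation_ge1//= -(@ler_sqr _ (kernel_scale j)) ?nnegrE ?sqrtr_ge0//.
rewrite sqr_sqrtr; last by rewrite addr_ge0// mulr_ge0.
have /andP[b0 b1] := beta_itv j; lra.
Qed.

Lemma scale_coords_ell2 (s : indices D -> R) (x : T) : (forall j, 0 <= s j <=
  2) ->
  ell2 beta x -> ell2 beta (scale_coords R D s x).
Proof.
move=> s02; apply: (sumJ_finite_le R D _ _ 4) => // j.
- by rewrite mulr_ge0// sqr_ge0.
- by rewrite mulr_ge0// sqr_ge0.
rewrite /scale_coords exprMn mulrCA ler_wpM2r//.
  by rewrite mulr_ge0// sqr_ge0.
by have /andP[s0 s2] := s02 j; rewrite expr2; nra.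
Qed.

(** Each factor satisfies 1 - beta_j^2 >= 1 - beta_j = 1 / (1 + 2 sigma_j^2) >= exp (- 2 sigma_j^2),
    and the sigma_j^2 are summable. *)
Lemma kernel_constant_gt0 : 0 < kernel_constant.
Proof.
apply: (prodJ_gt0 R D _ (fun j => sigma j ^+ 2)) => // j; first exact: sqr_ge0.
have /andP[b0 b1] := beta_itv j.
have b2 : 0 <= beta j ^+ 2 by exact: sqr_ge0.
apply/andP; split; last by rewrite -[leRHS]sqrtr1 ler_wsqrtr//; lra.
rewrite -(@ger0_norm _ (expR _)) ?expR_ge0// -sqrtr_sqr ler_wsqrtr//.
apply: (@le_trans _ _ (1 - beta j)); last by rewrite lerD2l lerN2 expr2; nra.
rewrite -expRM_natl mulrN expRN hbeta div1r lef_pV2 ?posrE ?expR_gt0//.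
  exact: expR_ge1Dx.
by rewrite addr_gt0// mulr_gt0// exprn_gt0.
Qed.

Lemma kernel_weight_gt0 x : ell2 beta x -> 0 < kernel_weight x.
Proof.
move=> Xx; rewrite mulr_gt0 ?sqrtr_gt0 ?kernel_constant_gt0//.
by move: Xx; rewrite -ell2_half_beta gauss_weight_gt0.
Qed.

(** Since s_j^2 = 1 + beta_j cancels that factor of 1 - beta_j^2, the exponents add up to - beta_j
    (u - v)^2 / (2 (1 - beta_j)), and beta_j / (2 (1 - beta_j)) is sigma_j^2. *)
Lemma gauss_mehler j (u v : R) :
  expR (- (sigma j ^+ 2 * (u - v) ^+ 2)) =
  Num.sqrt (1 - beta j ^+ 2) * expR (- (beta j / 2 * u ^+ 2)) *
  expR (- (beta j / 2 * v ^+ 2)) *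
  mehler_kernel R (beta j) (kernel_scale j * u) (kernel_scale j * v).
Proof.
have /andP[b0 b1] := beta_itv j.
have sE : sigma j ^+ 2 = beta j / (2 * (1 - beta j)).
  by rewrite -{1}sigma_beta; field; rewrite subr_eq0 gt_eqF.
have k2 : kernel_scale j ^+ 2 = 1 + beta j.
  by rewrite sqr_sqrtr ?addr_ge0 ?mulr_ge0// mulrC divfK.
have c0 : Num.sqrt (1 - beta j ^+ 2) != 0.
  by rewrite gt_eqF// sqrtr_gt0 subr_gt0 exprn_ilt1.
rewrite /mehler_kernel; set E := expR (_ / _).
rewrite (_ : _ * _ * _ * _ = expR (- (beta j / 2 * u ^+ 2)) *
    expR (- (beta j / 2 * v ^+ 2)) * E); last by field.
rewrite /E -!expRD; congr expR; rewrite !exprMn k2 sE.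
rewrite [kernel_scale j * u * _]mulrACA -expr2 k2.
by field; rewrite !subr_eq0 !gt_eqF// exprn_ilt1.
Qed.

Lemma hermite_kernelE (x y : T) :
  hermite_kernel beta x y = prodJ (fun j => mehler_kernel R (beta j) (x j) (y
    j)).
Proof.
congr prodJ; apply/funext => j; have /andP[b0 b1] := beta_itv j.
rewrite -mehler_formula ?(ltW b0)//; congr (limn _); rewrite /pseries.
by congr series; apply/funext => k; rewrite /mehler_coef -mulrA mulrC.
Qed.

Let gauss01 (y : T) j t : 0 <= expR (- (sigma j ^+ 2 * (t - y j) ^+ 2)) <= 1.
Proof.
by rewrite expR_ge0 /= -[leRHS]expR0 ler_expR oppr_le0 mulr_ge0// sqr_ge0.
Qed.

Let weight01 (x : T) j : 0 <= expR (- (beta j / 2 * x j ^+ 2)) <= 1.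
Proof.
by rewrite expR_ge0 /= -[leRHS]expR0 ler_expR oppr_le0 mulr_ge0// sqr_ge0.
Qed.

Let const01 j : 0 <= Num.sqrt (1 - beta j ^+ 2) <= 1.
Proof.
rewrite sqrtr_ge0 /= -[leRHS]sqrtr1 ler_wsqrtr//.
by rewrite lerBlDr lerDl sqr_ge0.
Qed.

(** The Mehler factors may exceed 1, so monotonicity does not give convergence of their product. Its
    partial products are quotients of convergent ones, and membership of x and y in [ell2 beta]
    makes the limit of the denominators nonzero. *)
Lemma gauss_kernel_hermite_kernel (x y : T) : ell2 beta x -> ell2 beta y ->
  gauss_kernel sigma x y = kernel_weight x * kernel_weight y *
    hermite_kernel beta (scale_coords R D kernel_scale x)
      (scale_coords R D kernel_scale y).
Proof.
move=> Xx Xy; rewrite hermite_kernelE.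
set mk := fun j => mehler_kernel _ _ _ _.
set cw := fun j => Num.sqrt (1 - beta j ^+ 2).
set gx := fun j => expR (- (beta j / 2 * x j ^+ 2)).
set gy := fun j => expR (- (beta j / 2 * y j ^+ 2)).
have c_cvg : partial_prod R D cw n @[n --> \oo] --> kernel_constant.
  exact: cvg_partial_prod.
have gx_cvg := cvg_partial_prod R D gx (weight01 x).
have gy_cvg := cvg_partial_prod R D gy (weight01 y).
have l_cvg := cvg_partial_prod R D _ (fun j => gauss01 y j (x j)).
have gx0 : 0 < prodJ gx by move: Xx; rewrite -ell2_half_beta gauss_weight_gt0.
have gy0 : 0 < prodJ gy by move: Xy; rewrite -ell2_half_beta gauss_weight_gt0.
have den0 : kernel_constant * prodJ gx * prodJ gy != 0.
  by rewrite !mulf_neq0 ?gt_eqF// kernel_constant_gt0.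
have mk_cvg : partial_prod R D mk n @[n --> \oo] -->
    gauss_kernel sigma x y / (kernel_constant * prodJ gx * prodJ gy).
  pose l := fun j => expR (- (sigma j ^+ 2 * (x j - y j) ^+ 2)).
  rewrite (_ : partial_prod R D mk = fun n => partial_prod R D l n *
      (partial_prod R D cw n * partial_prod R D gx n * partial_prod R D gy
        n)^-1).
    exact: (cvgM l_cvg (cvgV den0 (cvgM (cvgM c_cvg gx_cvg) gy_cvg))).
  apply/funext => n; rewrite /partial_prod.
  have prod0 : (\prod_(j <- initial_indices D n) cw j) *
      (\prod_(j <- initial_indices D n) gx j) *
      (\prod_(j <- initial_indices D n) gy j) != 0.
    rewrite !mulf_neq0// prodf_seq_neq0; apply/allP => j _ /=;
      rewrite gt_eqF ?expR_gt0// sqrtr_gt0 subr_gt0 exprn_ilt1//;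
      by have /andP[/ltW b0 b1] := beta_itv j.
  apply: (mulIf prod0); rewrite mulfVK//.
  rewrite mulrC -!big_split /=; apply: eq_bigr => j _.
  by rewrite /l gauss_mehler.
rewrite prodJE (cvg_lim _ mk_cvg)//.
have wE z : kernel_weight z = Num.sqrt kernel_constant *
  prodJ (fun j => expR (- (beta j / 2 * z j ^+ 2))) by [].
have -> : kernel_weight x * kernel_weight y = kernel_constant * prodJ gx *
  prodJ gy.
  rewrite !wE -/gx -/gy -{3}[kernel_constant]sqr_sqrtr; last first.
    exact: ltW kernel_constant_gt0.
  by ring.
by rewrite mulrC divfK.
Qed.

Lemma gauss_kernel_diag (x : T) : gauss_kernel sigma x x = 1.
Proof.
rewrite /gauss_kernel prodJE; apply: lim_near_cst => //; apply: nearW => n.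
by rewrite /partial_prod big1// => j _; rewrite subrr expr0n mulr0 oppr0 expR0.
Qed.

Lemma measurable_gauss_kernel (y : T) : measurable_fun setT (gauss_kernel sigma
  ^~ y).
Proof.
apply: (measurable_prodJ R D
  (fun j t => expR (- (sigma j ^+ 2 * (t - y j) ^+ 2)))) => j;
    last exact: gauss01.
apply: measurableT_comp => //; apply: measurableT_comp => //.
apply: measurable_funM => //; apply: measurable_funX; exact: measurable_funB.
Qed.

(** The integral of the Gaussian kernel with its second argument fixed at 0. *)
Definition gauss_mean : R := prodJ (fun j => Num.sqrt (1 - beta j)).

Lemma integral_gauss_kernel (mu : probability T R) (y : T) : is_normal_product
  mu ->
  (\int[mu]_x (gauss_kernel sigma x y)%:E =
   (gauss_mean * gauss_weight R D (fun j => beta j / 2) y)%:E)%E.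
Proof.
move=> hmu.
have s2 j : 0 < 1 + 2 * sigma j ^+ 2 by rewrite addr_gt0// mulr_gt0// exprn_gt0.
have q01 j : 0 <= Num.sqrt (1 - beta j) <= 1.
  have /andP[b0 b1] := beta_itv j.
  by rewrite sqrtr_ge0 /= -[leRHS]sqrtr1 ler_wsqrtr// lerBlDr lerDl ltW.
have qw01 j : 0 <= Num.sqrt (1 - beta j) * expR (- (beta j / 2 * y j ^+ 2)) <=
  1.
  have /andP[q0 q1] := q01 j; have /andP[w0 w1] := weight01 y j.
  by rewrite mulr_ge0//= mulr_ile1.
rewrite (integral_prodJ R D mu hmu
  (fun j t => expR (- (sigma j ^+ 2 * (t - y j) ^+ 2))) _ (gauss01 y) _ qw01).
- congr EFin; apply: (cvg_unique (@norm_hausdorff _ R) (cvg_partial_prod R D _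
  qw01)).
  rewrite (_ : partial_prod R D _ =
    fun n => partial_prod R D (fun j => Num.sqrt (1 - beta j)) n *
             partial_prod R D (fun j => expR (- (beta j / 2 * y j ^+ 2))) n).
    exact: (cvgM (cvg_partial_prod R D _ q01) (cvg_partial_prod R D _ (weight01
      y))).
  by apply/funext => n; rewrite /partial_prod big_split.
- move=> j; apply: measurableT_comp => //; apply: measurableT_comp => //.
  apply: measurable_funM => //; apply: measurable_funX; exact: measurable_funB.
- move=> j; rewrite integral_std_normal_gauss ?sqr_ge0//;
  congr (_ * expR (- (_ * _)))%:E.
    by rewrite hbeta div1r sqrtrV// ltW.
  by rewrite -[in RHS]sigma_beta hbeta; field; rewrite gt_eqF.
Qed.

(** Factor 1 - beta_j^2 as (1 + beta_j) (1 - beta_j) and cancel sqrt (1 + beta_j) = s_j. This ties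
    the representer of integration to the ratio r. *)
Lemma gauss_meanE : gauss_mean = kernel_constant * prodJ (fun j =>
  (kernel_scale j)^-1).
Proof.
have q01 j : 0 <= Num.sqrt (1 - beta j) <= 1.
  have /andP[b0 b1] := beta_itv j.
  by rewrite sqrtr_ge0 /= -[leRHS]sqrtr1 ler_wsqrtr// lerBlDr lerDl ltW.
apply: (cvg_unique (@norm_hausdorff _ R) (cvg_partial_prod R D _ q01)).
rewrite (_ : partial_prod R D _ =
  fun n => partial_prod R D (fun j => Num.sqrt (1 - beta j ^+ 2)) n *
           partial_prod R D (fun j => (kernel_scale j)^-1) n).
  exact: (cvgM (cvg_partial_prod R D _ const01)
    (cvg_partial_prod R D _ (dilationV_itv R D _ half_beta_ge0))).
apply/funext => n; rewrite /partial_prod -big_split.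
apply: eq_bigr => j _ /=; have /andP[b0 b1] := beta_itv j.
have k2 : 2 * (beta j / 2) = beta j by rewrite mulrC divfK.
rewrite /kernel_scale /dilation k2 (_ : 1 - _ ^+ 2 = (1 + beta j) * (1 - beta
  j)).
  by rewrite sqrtrM ?addr_ge0// mulrAC mulfV ?mul1r// gt_eqF// sqrtr_gt0
    addr_gt0.
by ring.
Qed.

(** Here s_j = sqrt (1 + beta_j) <= 1 + beta_j <= exp beta_j, with summable exponents. *)
Lemma kernel_scaleV_prod_gt0 : 0 < prodJ (fun j => (kernel_scale j)^-1).
Proof.
apply: (prodJ_gt0 R D _ beta beta_ge0 beta_sum) => j.
have /andP[d0 d1] := dilationV_itv R D _ half_beta_ge0 j.
rewrite d1 andbT expRN lef_pV2 ?posrE ?expR_gt0//; last first.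
  by rewrite (lt_le_trans ltr01)//; have /andP[] := kernel_scale_itv j.
have b1 : 1 <= 1 + beta j by rewrite lerDl.
apply: le_trans (expR_ge1Dx (beta j)).
have k2 : 2 * (beta j / 2) = beta j by rewrite mulrC divfK.
rewrite /kernel_scale /dilation k2.
rewrite -[leRHS]ger0_norm ?addr_ge0// -sqrtr_sqr ler_wsqrtr// expr2.
by rewrite ler_peMr// addr_ge0.
Qed.

End gauss_hermite_kernels.

(** * Transfer of integrals, quadratures and errors *)

Section gauss_hermite_errors.
Context (R : realType) (D : index_kind) (mu : probability (RJ R D) R).
Hypothesis hmu : is_normal_product mu.
Local Notation T := (RJ R D).
Variables sigma beta : indices D -> R.
Hypotheses (sigma_gt0 : forall j, 0 < sigma j)
  (sigma_sum : sumJ_finite (fun j => sigma j ^+ 2))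
  (hbeta : forall j, 1 - beta j = 1 / (1 + 2 * sigma j ^+ 2)).
Local Notation X := (ell2 beta : set T).
Variables (HL : RKHS X (gauss_kernel sigma)) (HK : RKHS X (hermite_kernel
  beta)).

Let w := kernel_weight R D beta.
Let S := scale_coords R D (kernel_scale R D beta).
Let Sinv := scale_coords R D (fun j => (kernel_scale R D beta j)^-1).
Let kappa : R := prodJ (fun j => (kernel_scale R D beta j)^-1).
Let cst_sqrt : R := Num.sqrt (kernel_constant R D beta).

Definition error_ratio : R := cst_sqrt * kappa.

Let beta_ge0 j : 0 <= beta j.
Proof. by have /andP[/ltW] := beta_itv R D sigma beta sigma_gt0 hbeta j. Qed.

Let half_beta_ge0 j : 0 <= beta j / 2. Proof. by rewrite divr_ge0. Qed.

Let scale_itv j : 1 <= kernel_scale R D beta j <= 2.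
Proof. exact: (kernel_scale_itv R D sigma). Qed.

Let scale_gt0 j : 0 < kernel_scale R D beta j.
Proof. by have /andP[s1 _] := scale_itv j; exact: lt_le_trans s1. Qed.

Let w_gt0 x : X x -> 0 < w x.
Proof. exact: (kernel_weight_gt0 R D sigma). Qed.

Let cst_sqrt_gt0 : 0 < cst_sqrt.
Proof. by rewrite sqrtr_gt0; exact: (kernel_constant_gt0 R D sigma). Qed.

Let kappa_gt0 : 0 < kappa.
Proof. exact: (kernel_scaleV_prod_gt0 R D sigma). Qed.

Lemma error_ratio_gt0 : 0 < error_ratio.
Proof. by rewrite mulr_gt0. Qed.

Let SK x : S (Sinv x) = x.
Proof. by apply/funext => j;
  rewrite /S /Sinv /scale_coords mulVKf// gt_eqF. Qed.

Let SinvK x : Sinv (S x) = x.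
Proof. by apply/funext => j; rewrite /S /Sinv /scale_coords mulKf// gt_eqF. Qed.

Let SX x : X x -> X (S x).
Proof.
apply: (scale_coords_ell2 R D sigma) => //.
by move=> j; have /andP[s1 ->] := scale_itv j; rewrite ltW.
Qed.

Let SinvX x : X x -> X (Sinv x).
Proof.
apply: (scale_coords_ell2 R D sigma) => //.
move=> j; have /andP[s1 _] := scale_itv j.
rewrite invr_ge0 ltW//=; apply: (@le_trans _ _ 1); last by rewrite ler1n.
by rewrite invf_le1.
Qed.

Let kernelE x y : X x -> X y ->
  gauss_kernel sigma x y = w x * w y * hermite_kernel beta (S x) (S y).
Proof. exact: (gauss_kernel_hermite_kernel R D sigma). Qed.

Lemma hermite_to_gauss (F : HK) : exists2 f : HL,
  (forall x, X x -> rkhs_eval f x = w x * rkhs_eval F (S x)) & `|f| = `|F|.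
Proof.
apply: (rkhs_weighted_comp R T T X X _ _ HL HK w S) => //.
- by move=> x Xx; rewrite gt_eqF ?w_gt0.
- by move=> y Xy; exists (Sinv y); [exact: SinvX|exact: SK].
Qed.

(** The inverse map is again a weighted composition, along [Sinv] with weight 1 / w (Sinv y), so
    surjectivity of the isometry comes from the same general result. *)
Lemma gauss_to_hermite (f : HL) : exists2 F : HK,
  (forall x, X x -> rkhs_eval f x = w x * rkhs_eval F (S x)) & `|f| = `|F|.
Proof.
have wS x : X x -> w (Sinv x) != 0 by move=> Xx; rewrite gt_eqF// w_gt0//;
  exact: SinvX.
have [F FE normF] : exists2 F : HK, (forall y, X y ->
    rkhs_eval F y = (w (Sinv y))^-1 * rkhs_eval f (Sinv y)) & `|F| = `|f|.
  apply: (rkhs_weighted_comp R T T X X _ _ HK HL (fun y => (w (Sinv y))^-1)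
    Sinv) => //.
  - by move=> y Xy; rewrite invr_neq0// wS.
  - by move=> x Xx; exists (S x); [exact: SX|exact: SinvK].
  - move=> x y Xx Xy; rewrite kernelE; [|exact: SinvX..]; rewrite !SK.
    by field; rewrite !wS.
exists F => // x Xx; rewrite (FE _ (SX _ Xx)) SinvK mulVKf//.
by rewrite gt_eqF ?w_gt0.
Qed.

Let mX : measurable X. Proof. exact: measurable_ell2. Qed.

Let muX : mu X = 1%E.
Proof.
apply: probability_ell2 => //.
exact: (beta_sum R D sigma).
Qed.

Lemma gauss_eval_bound (f : HL) x : X x -> `|rkhs_eval f x| <= `|f|.
Proof.
move=> Xx; have := rkhs_eval_bound _ _ _ _ HL x Xx f.
by rewrite gauss_kernel_diag sqrtr1 mulr1.
Qed.

Lemma measurable_gauss_eval (f : HL) : measurable_fun X (rkhs_eval f).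
Proof.
apply: rkhs_measurable => // y _; apply: measurable_funTS.
exact: measurable_gauss_kernel.
Qed.

Lemma integrable_gauss_eval (f : HL) : mu.-integrable X (EFin \o rkhs_eval f).
Proof.
have mf := measurable_gauss_eval f.
have : mu.-integrable X (cst (`|f|)%:E).
  apply/integrableP; split; first exact: measurable_cst.
  rewrite (eq_integral (cst (`|f|)%:E)); last by move=> x _;
    rewrite /= normr_id.
  by rewrite integral_cst// [Y in (_ * Y)%E]muX mule1 ltry.
apply: le_integrable => //; first exact/measurable_EFinP.
move=> x Xx; rewrite /= lee_fin normr_id.
exact: gauss_eval_bound.
Qed.

Let weightE (A : set T) : measurable A ->
  (\int[mu]_(x in S @^-1` A) (gauss_weight R D (fun j => beta j / 2) x)%:E =
   kappa%:E * mu A)%E.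
Proof. exact: integral_gauss_weight_dilation. Qed.

Let weight_ge0 (x : T) : 0 <= gauss_weight R D (fun j => beta j / 2) x.
Proof. by have /andP[] := gauss_weight_itv R D _ half_beta_ge0 x. Qed.

Let mweight : measurable_fun setT (gauss_weight R D (fun j => beta j / 2)).
Proof. exact: measurable_gauss_weight. Qed.

Let mS : measurable_fun setT S. Proof. exact: measurable_scale_coords. Qed.

Let mSinv : measurable_fun setT Sinv. Proof. exact: measurable_scale_coords.
  Qed.

(** Rescaling of the measure requires an integrable function on the whole space. Both functions are
    extended by 0 off [X], compatibly since [S] and [Sinv] preserve [X], and the properties needed
    of F are taken from f. *)
Lemma integral_gauss_hermite (f : HL) (F : HK) :
  (forall x, X x -> rkhs_eval f x = w x * rkhs_eval F (S x)) ->
  (\int[mu]_(x in X) (rkhs_eval f x)%:E =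
   error_ratio%:E * \int[mu]_(x in X) (rkhs_eval F x)%:E)%E.
Proof.
move=> fF.
pose fX : T -> \bar R := (EFin \o rkhs_eval f) \_ X.
pose FX : T -> \bar R := (EFin \o rkhs_eval F) \_ X.
have ifX : mu.-integrable setT fX.
  exact: (integrable_mkcond _ mX).1 (integrable_gauss_eval f).
(* F is recovered from f, which yields its measurability; the reciprocal is written as a real power
   because that is measurable on the whole line. *)
have FXE : FX = fun y => ((w (Sinv y) `^ (-1))%:E * fX (Sinv y))%E.
  apply/funext => y; rewrite /FX /fX !patchE.
  case: ifPn => [/set_mem Xy|yX].
    rewrite mem_set; last exact: SinvX.
    rewrite /= fF; last exact: SinvX.
    rewrite SK -EFinM powR_inv1; last by rewrite ltW// w_gt0//; exact: SinvX.
    by rewrite mulKf// gt_eqF// w_gt0//; exact: SinvX.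
  rewrite memNset ?mule0// => Xy; move/negP: yX; apply; apply/mem_set.
  by rewrite -(SK y); exact: SX.
have mFX : measurable_fun setT FX.
  rewrite FXE; apply: emeasurable_funM.
    have mw : measurable_fun setT w by exact: measurable_funM.
    apply/measurable_EFinP.
    exact: (measurableT_comp (measurable_powR (-1 : R)) (measurableT_comp mw
      mSinv)).
  exact: (measurableT_comp (measurable_int _ ifX) mSinv).
have fXE x : fX x = (cst_sqrt%:E *
    ((gauss_weight R D (fun j => beta j / 2) x)%:E * FX (S x)))%E.
  rewrite /FX /fX !patchE; case: ifPn => [/set_mem Xx|xX].
    by rewrite mem_set; [rewrite /= fF// /w /kernel_weight -!EFinM mulrA|exact:
      SX].
  rewrite memNset ?mule0// => Xx; move/negP: xX; apply; apply/mem_set.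
  by rewrite -(SinvK x); exact: SinvX.
(* The nonnegative change of variables equates kappa times the integral of |FX| with that of |fX| /
   sqrt c, which is finite; kappa > 0 then excludes an infinite value. *)
have iFX : mu.-integrable setT FX.
  apply/integrableP; split => //.
  have mabs : measurable_fun setT (abse \o FX) by exact: measurableT_comp.
  have := ge0_integral_weighted_comp R _ _ T T mu mu _ S kappa weight_ge0
    mweight mS
    weightE (abse \o FX) mabs (fun y => abse_ge0 (FX y)).
  have bound : (\int[mu]_x ((gauss_weight R D (fun j => beta j / 2) x)%:E *
      (abse \o FX) (S x)) < +oo)%E.
    have iZ := integrableZl measurableT cst_sqrt^-1 ifX.
    have /integrableP[_] := iZ.
    apply: le_lt_trans; rewrite le_eqVlt; apply/orP; left; apply/eqP.
    apply: eq_integral => x _ /=;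
      rewrite fXE muleA -EFinM mulVf ?gt_eqF// mul1e.
    by rewrite abseM [`|_%:E|%E]gee0_abs ?lee_fin.
  move=> cE; rewrite cE in bound; rewrite ltey; apply/eqP => ioo.
  by move: bound; rewrite [Y in (_ * Y)%E]ioo gt0_muley ?lte_fin.
have [iG GE] := integral_weighted_comp R _ _ T T mu mu _ S kappa weight_ge0
  mweight mS
  (ltW kappa_gt0) weightE FX iFX.
rewrite integral_mkcond -/fX [in RHS]integral_mkcond -/FX.
rewrite /error_ratio EFinM -muleA -GE -integralZl//.
by apply: eq_integral => x _; exact: fXE.
Qed.

(** The factor w x comes from f x = w x * F (S x); dividing by r makes the quadrature values scale
    by r exactly as the integrals do. *)
Definition hermite_quadrature (A : quadrature R D) : quadrature R D :=
  [seq (S p.1, error_ratio^-1 * w p.1 * p.2) | p <- A].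

Lemma quad_apply_gauss_hermite (f : HL) (F : HK) (A : quadrature R D) :
  (forall x, X x -> rkhs_eval f x = w x * rkhs_eval F (S x)) -> nodes_in X A ->
  quad_apply A (rkhs_eval f) =
  error_ratio * quad_apply (hermite_quadrature A) (rkhs_eval F).
Proof.
move=> fF; rewrite /quad_apply big_map mulr_sumr.
elim: A => [|p A IH] XA; first by rewrite !big_nil.
rewrite !big_cons IH; last by move=> q qA; apply: XA; rewrite inE qA orbT.
congr (_ + _); rewrite fF; last by apply: XA; rewrite mem_head.
by rewrite /=; field; rewrite gt_eqF ?error_ratio_gt0.
Qed.

Lemma wc_error_gauss_hermite (A : quadrature R D) : nodes_in X A ->
  wc_error mu HL A = (error_ratio%:E * wc_error mu HK (hermite_quadrature A))%E.
Proof.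
move=> XA; rewrite /wc_error -ereal_sup_pZl ?error_ratio_gt0//; congr ereal_sup.
set A' := hermite_quadrature A.
have dist (f : HL) (F : HK) :
    (forall x, X x -> rkhs_eval f x = w x * rkhs_eval F (S x)) ->
    (`|\int[mu]_(x in X) (rkhs_eval f x)%:E - (quad_apply A (rkhs_eval f))%:E| =
     error_ratio%:E *
     `|\int[mu]_(x in X) (rkhs_eval F x)%:E - (quad_apply A' (rkhs_eval
       F))%:E|)%E.
  move=> fF; rewrite (integral_gauss_hermite _ _ fF) (quad_apply_gauss_hermite
    _ _ _ fF XA).
  rewrite [(_ * quad_apply _ _)%:E]EFinM.
  rewrite -muleBr//; last by rewrite fin_num_adde_defl.
  by rewrite abseM gee0_abs// lee_fin ltW ?error_ratio_gt0.
apply/seteqP; split => [_ [f f1 <-]|_ [_ [F F1 <-] <-]].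
  have [F fF normF] := gauss_to_hermite f.
  by exists (`|\int[mu]_(x in X) (rkhs_eval F x)%:E -
    (quad_apply A' (rkhs_eval F))%:E|)%E; [exists F => //=;
      rewrite -normF|rewrite (dist f F)].
have [f fF normF] := hermite_to_gauss F.
by exists f; [rewrite /= normF|rewrite (dist f F)].
Qed.
Let gauss_quadrature (A : quadrature R D) : quadrature R D :=
  [seq (Sinv q.1, error_ratio * (w (Sinv q.1))^-1 * q.2) | q <- A].

Let gauss_quadratureK (A : quadrature R D) : nodes_in X A ->
  hermite_quadrature (gauss_quadrature A) = A.
Proof.
move=> XA; rewrite /hermite_quadrature /gauss_quadrature -map_comp.
rewrite -[RHS]map_id; apply/eq_in_map => -[x a] xA /=.
have Xx : X x by exact: XA xA.
have wx : w (Sinv x) != 0 by rewrite gt_eqF// w_gt0//; exact: SinvX.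
congr (_, _); first exact: SK.
by field; rewrite wx gt_eqF ?error_ratio_gt0.
Qed.

Let nodes_in_hermite A : nodes_in X A -> nodes_in X (hermite_quadrature A).
Proof. by move=> XA _ /mapP[p pA ->]; apply: SX; exact: XA. Qed.

Let nodes_in_gauss A : nodes_in X A -> nodes_in X (gauss_quadrature A).
Proof. by move=> XA _ /mapP[p pA ->]; apply: SinvX; exact: XA. Qed.

Lemma point_cost_scale_coords price (s : indices D -> R) (x : T) :
  (forall j, s j != 0) ->
  point_cost price (scale_coords R D s x) = point_cost price x.
Proof.
move=> s0; rewrite /point_cost; move: s s0 x; case: D => [d|] s s0 x //=.
rewrite (_ : [set j | scale_coords R CountableIndices s x j != 0] = [set j | x
  j != 0])//.
by apply/seteqP; split => j /=; rewrite /scale_coords mulf_eq0 negb_or (s0 j).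
Qed.

Lemma cost_hermite_quadrature price (A : quadrature R D) :
  cost price (hermite_quadrature A) = cost price A.
Proof.
rewrite /cost big_map; apply: eq_bigr => p _.
by apply: point_cost_scale_coords => j; rewrite gt_eqF.
Qed.

(** The correspondence of quadratures is onto, keeps nodes in [X] and preserves cost, so the two
    infima run over families of errors that differ by the positive factor r. *)
Lemma minimal_error_gauss_hermite price n :
  minimal_error mu HL price n = (error_ratio%:E * minimal_error mu HK price
    n)%E.
Proof.
(* The initial error is the error of the empty quadrature, which reduces n = 0 to the scaling of
   worst-case errors. *)
have initialE (M : T -> T -> R) (H : RKHS X M) : initial_error mu H = wc_error
  mu H [::].
  rewrite /initial_error /wc_error /quad_apply; congr ereal_sup.
  by apply/seteqP; split => _ [f f1 <-]; exists f => //; rewrite big_nil sube0.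
case: n => [|n].
  rewrite /minimal_error !initialE wc_error_gauss_hermite//.
rewrite /minimal_error -ereal_inf_pZl ?error_ratio_gt0//; congr ereal_inf.
apply/seteqP; split => [_ [A [XA cA] <-]|_ [_ [A [XA cA] <-] <-]].
  exists (wc_error mu HK (hermite_quadrature A));
    last by rewrite wc_error_gauss_hermite.
  exists (hermite_quadrature A) => //.
  by split; [exact: nodes_in_hermite|rewrite cost_hermite_quadrature].
exists (gauss_quadrature A).
  split; first exact: nodes_in_gauss.
  by rewrite -cost_hermite_quadrature gauss_quadratureK.
rewrite wc_error_gauss_hermite; last exact: nodes_in_gauss.
by rewrite gauss_quadratureK.
Qed.

(** The complement of [X] is a null set, so the coordinatewise computation over the whole space
    applies. *)
Lemma integral_gauss_kernel_ell2 (y : T) : X y ->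
  (\int[mu]_(x in X) (gauss_kernel sigma x y)%:E =
   (gauss_mean R D beta * gauss_weight R D (fun j => beta j / 2) y)%:E)%E.
Proof.
move=> Xy; rewrite -(integral_gauss_kernel R D sigma beta sigma_gt0 hbeta mu y
  hmu).
have mL : measurable_fun setT (fun x => (gauss_kernel sigma x y)%:E).
  by apply/measurable_EFinP; exact: measurable_gauss_kernel.
have mXC : measurable (~` X) by exact: measurableC.
have muXC : mu (~` X) = 0%E by rewrite probability_setC// muX subee.
rewrite -[in RHS](setUv X) ge0_integral_setU//.
- rewrite [Y in (_ + Y)%E]null_set_integral ?adde0//;
  first exact: measurable_funTS.
- by rewrite setUv.
- move=> x _; rewrite lee_fin.
  have g01 j : 0 <= expR (- (sigma j ^+ 2 * (x j - y j) ^+ 2)) <= 1.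
    by rewrite expR_ge0 /= -[leRHS]expR0 ler_expR oppr_le0 mulr_ge0// sqr_ge0.
  by have /andP[] := prodJ_itv R D _ g01.
- by apply/disj_setPCl.
Qed.

Lemma initial_error_gauss_kernel : initial_error mu HL = error_ratio%:E.
Proof.
have int_fin (f : HL) : (\int[mu]_(x in X) (rkhs_eval f x)%:E)%E \is a fin_num.
  exact: integrable_fin_num (integrable_gauss_eval f).
pose I (f : HL) : R := \int[mu]_(x in X) rkhs_eval f x.
have IE (f : HL) : (\int[mu]_(x in X) (rkhs_eval f x)%:E)%E = (I f)%:E.
  by rewrite /I /Rintegral fineK.
have I_linear a (f g : HL) : I (a *: f + g) = a * I f + I g.
  have ia := integrable_gauss_eval f; have ig := integrable_gauss_eval g.
  rewrite /I -RintegralZl// -RintegralD//; last first.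
    by have := integrableZl mX a ia; apply: eq_integrable => // x _ /=;
      rewrite EFinM.
  by apply: eq_Rintegral => x /set_mem Xx; rewrite rkhs_eval_linear.
(* L (x, x) = 1 bounds the values of f by its norm, and [mu] has total mass 1. *)
have I_bounded (f : HL) : `|I f| <= 1 * `|f|.
  rewrite mul1r -lee_fin -abse_EFin -IE.
  have mf : measurable_fun X (EFin \o rkhs_eval f).
    by apply/measurable_EFinP; exact: measurable_gauss_eval.
  apply: le_trans (le_abse_integral _ mX mf) _.
  apply: (@le_trans _ _ (\int[mu]_(x in X) cst (`|f|)%:E x)%E).
    apply: ge0_le_integral => //; first exact: measurableT_comp.
    by move=> x Xx; rewrite /= lee_fin; exact: gauss_eval_bound.
  by rewrite integral_cst// [Y in (_ * Y)%E]muX mule1.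
have ip_sym := @rkhs_inner_sym _ _ _ _ HL.
have ip_lin := @rkhs_inner_linear _ _ _ _ HL.
have ip_norm := @rkhs_inner_norm _ _ _ _ HL.
have [k kI] := riesz_representation R HL _ ip_sym ip_lin ip_norm I 1 I_linear
  I_bounded.
have kE y : X y -> rkhs_eval k y =
    gauss_mean R D beta * gauss_weight R D (fun j => beta j / 2) y.
  move=> Xy; have [ky kyE kyI] := rkhs_reproducing HL Xy.
  rewrite -kyI ip_sym -kI; apply: EFin_inj;
    rewrite -IE -integral_gauss_kernel_ell2//.
  by apply: eq_integral => x /set_mem Xx; rewrite kyE.
(* Presents the domain as a preimage, so that the rescaling evaluates the integral of g over [X] as
   kappa times the mass of [X]. *)
have preX : S @^-1` X = X.
  by apply/seteqP; split => x; [move=> /SinvX; rewrite SinvK|exact: SX].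
have normk : `|k| = error_ratio.
  apply/eqP; rewrite -(@eqrXn2 _ 2)// ?(ltW error_ratio_gt0)//; apply/eqP.
  rewrite -ip_norm -kI; apply: EFin_inj; rewrite -IE.
  transitivity (\int[mu]_(x in X) ((gauss_mean R D beta)%:E *
      (gauss_weight R D (fun j => beta j / 2) x)%:E))%E.
    by apply: eq_integral => x /set_mem Xx; rewrite kE// EFinM.
  rewrite ge0_integralZl_EFin//; last 3 first.
  - by move=> x _; rewrite lee_fin weight_ge0.
  - by apply: measurable_funTS; apply/measurable_EFinP.
  - by rewrite (gauss_meanE R D sigma)// mulr_ge0 ?ltW// (kernel_constant_gt0 R
    D sigma).
  rewrite -{1}preX weightE// muX mule1 -EFinM (gauss_meanE R D sigma)//.
  congr EFin; rewrite /error_ratio exprMn sqr_sqrtr;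
    last exact: ltW (kernel_constant_gt0 R D sigma _ _ _ _).
  by rewrite expr2 mulrA.
rewrite /initial_error; apply/eqP; rewrite eq_le; apply/andP; split.
  apply: ge_ereal_sup => _ [f /= f1 <-]; rewrite IE abse_EFin lee_fin kI.
  apply: le_trans (cauchy_schwarz R HL _ ip_sym ip_lin ip_norm f k) _.
  by rewrite normk ler_piMl// ltW// error_ratio_gt0.
(* The Cauchy-Schwarz bound is attained at the normalised representer. *)
apply: ereal_sup_ubound; exists (error_ratio^-1 *: k) => /=.
  by rewrite normrZ normk ger0_norm ?invr_ge0 ?(ltW error_ratio_gt0)// mulVf//
    gt_eqF// error_ratio_gt0.
rewrite IE kI (ipZl R HL _ ip_lin) ip_norm normk abse_EFin expr2.
by rewrite mulKf ?gt_eqF ?error_ratio_gt0// ger0_norm// ltW// error_ratio_gt0.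
Qed.

End gauss_hermite_errors.

Theorem corollary4p5 (R : realType) (D : index_kind) (hD : nonempty_indices D)
    (mu : probability (RJ R D) R) (hmu : is_normal_product mu)
    (price : nat -> R)
    (price_ge1 : forall m : nat, 1 <= price m)
    (price_nd : forall m m' : nat, (m <= m')%N -> price m <= price m')
    (sigma beta : indices D -> R)
    (sigma_gt0 : forall j, 0 < sigma j)
    (sigma_sum : sumJ_finite (fun j => sigma j ^+ 2))
    (hbeta : forall j, 1 - beta j = 1 / (1 + 2 * sigma j ^+ 2))
    (HL : RKHS (ell2 (fun j => sigma j ^+ 2)) (gauss_kernel sigma))
    (HK : RKHS (ell2 beta) (hermite_kernel beta))
    (n : nat) (hn : (0 < n)%N) :
  (minimal_error mu HL price n / minimal_error mu HL price 0)%E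
    = (minimal_error mu HK price n / minimal_error mu HK price 0)%E
  /\ (minimal_error mu HK price n / minimal_error mu HK price 0)%E
    = minimal_error mu HK price n.
Proof.
(* The type of [HL] depends on its domain; the equality of the two domains puts both spaces over the
   same set. *)
move: HL; rewrite (ell2_sigma_beta R D sigma beta sigma_gt0 sigma_sum hbeta) => HL.
have r0 := error_ratio_gt0 R D sigma beta sigma_gt0 sigma_sum hbeta.
have rfin : (error_ratio R D beta)%:E != 0%E by rewrite gt_eqF.
have EL := minimal_error_gauss_hermite R D mu hmu sigma beta sigma_gt0 sigma_sum
  hbeta HL HK price.
have L0 : minimal_error mu HL price 0 = (error_ratio R D beta)%:E.
  exact: (initial_error_gauss_kernel R D mu hmu sigma beta sigma_gt0 sigma_sum hbeta HL).
(* The scaling identity for n = 0 reads r = r e_0(K), and r is nonzero and finite. *)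
have K0 : minimal_error mu HK price 0 = 1%E.
  have := EL 0%N; rewrite L0 => /(congr1 (fun z => ((error_ratio R D beta)%:E^-1 * z)%E)).
  by rewrite muleA mulVe// mul1e.
by rewrite L0 K0 EL inve1 mule1 muleAC divee// mul1e.
Qed.
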